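(* (Quantum MacMahon Master Theorem) Let $r\ge 1$ and let $A=(a_{ij})_{1\le i,j\le r}$ be a right-quantum matrix of size $r$ of indeterminates. For $1\le i\le r$ let $X_i:=\sum_{j=1}^r a_{ij}x_j$, and for any vector $(m_1,\dots,m_r)$ of non-negative integers let $G(m_1,\dots,m_r)$ be the coefficient of $x_1^{m_1}x_2^{m_2}\cdots x_r^{m_r}$ in $\prod_{i=1}^r X_i^{m_i}=X_1^{m_1}X_2^{m_2}\cdots X_r^{m_r}$. Let $$\mathrm{Ferm}(A)=\sum_{J\subset\{1,\dots,r\}}(-1)^{|J|}\,{\det}_q(A_J),$$ where the sum is over all subsets $J$ of $\{1,\dots,r\}$ and $A_J$ is the $J$ by $J$ submatrix of $A$, and let $$\mathrm{Bos}(A)=\sum_{m_1,\dots,m_r=0}^\infty G(m_1,\dots,m_r).$$ Then $$\mathrm{Bos}(A)=1/\mathrm{Ferm}(A).$$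
   Context: Let $K$ be a commutative ring and $q\in K$ an invertible element. Quantum variables: $x_1,\dots,x_r$ are indeterminates satisfying $x_jx_i=q\,x_ix_j$ for all $1\le i<j\le r$. Right-quantum matrix: a matrix $A=(a_{ij})_{1\le i,j\le r}$ whose entries commute with all the $x_k$ and such that for all $1\le i<i'\le r$ and $1\le j<j'\le r$, writing $a=a_{ij}$, $b=a_{ij'}$, $c=a_{i'j}$, $d=a_{i'j'}$, one has $$ca=q\,ac,\qquad db=q\,bd,\qquad ad=da+q^{-1}cb-q\,bc$$ (the $q$-commutation of entries in a column is required for every column, including when $r=1$, where it is vacuous). Here the $a_{ij}$ are indeterminates subject only to these relations: let $R$ be the unital associative $K$-algebra generated by the $a_{ij}$ modulo these relations, and work in the algebra generated over $R$ by the $x_k$ (commuting with $R$, and with $x_jx_i=qx_ix_j$ for $i<j$), which is a free $R$-module on the ordered monomials $x_1^{m_1}\cdots x_r^{m_r}$; ''coefficient'' refers to this basis. Quantum determinant: for any $n\times n$ matrix $B=(b_{ij})$ with entries in a $K$-algebra, $${\det}_q(B)=\sum_{\pi\in S_n}(-q)^{-\mathrm{inv}(\pi)}\,b_{\pi_1 1}b_{\pi_2 2}\cdots b_{\pi_n n},$$ where $\mathrm{inv}(\pi)$ is the number of pairs $i<j$ with $\pi_i>\pi_j$. For $J\subset\{1,\dots,r\}$ the rows and columns of $A_J$ are listed in increasing order, and $\det_q(A_\emptyset)=1$. Infinite sums and inverse: the relations are homogeneous, so $R$ is graded with each $a_{ij}$ of degree $1$; $G(m_1,\dots,m_r)$ is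 homogeneous of degree $m_1+\dots+m_r$. The identity takes place in the completion $\hat R=\prod_{n\ge 0}R_n$ of $R$; $\mathrm{Ferm}(A)$ has degree-zero part $1$, hence is invertible there, and $1/\mathrm{Ferm}(A)$ denotes its two-sided inverse. *)

(* Defs.v *)
From HB Require Import structures.
From mathcomp Require Import all_boot all_algebra perm finmap monalg.
From mathcomp Require Import boolp classical_sets cardinality fsbigop.

Set Implicit Arguments.
Unset Strict Implicit.
Unset Printing Implicit Defensive.

Import GRing.Theory.
Local Open Scope ring_scope.
Local Open Scope quotient_scope.

Section QuantumDeterminant.
Variables (K : comUnitRingType) (q : K) (L : algType K).

Definition perm_inv n (s : 'S_n) : nat :=
  #|[set ij : 'I_n * 'I_n | (ij.1 < ij.2)%N && (s ij.2 < s ij.1)%N]|.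

Definition qdet n (B : 'M[L]_n) : L :=
  \sum_(s : 'S_n) (- q) ^- perm_inv s *: \prod_(j < n) B (s j) j.

(* [enum_val] lists the elements of J in increasing order. *)
Definition principal_submx r (A : 'M[L]_r) (J : {set 'I_r}) : 'M[L]_#|J| :=
  \matrix_(i, j) A (enum_val i) (enum_val j).

Definition Ferm r (A : 'M[L]_r) : L :=
  \sum_(J : {set 'I_r}) (-1) ^+ #|J| * qdet (principal_submx A J).

(* The condition that the entries commute with the x_k is built into [qspace] *)
(* below.                                                                     *)
Definition right_quantum r (A : 'M[L]_r) : Prop :=
  (forall i i' j : 'I_r, (i < i')%N -> A i' j * A i j = q *: (A i j * A i' j))
  /\
  (forall i i' j j' : 'I_r, (i < i')%N -> (j < j')%N ->
     A i j * A i' j' =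
     A i' j' * A i j + q^-1 *: (A i' j * A i j') - q *: (A i j' * A i' j)).

End QuantumDeterminant.

Section TwistedProduct.
Variables (K : comUnitRingType) (q : K) (L : algType K) (r : nat).
Local Notation mon := {ffun 'I_r -> nat}.
Local Notation S := {malg L[mon]}.
Implicit Types (p s : S) (m l : mon) (a b : L).

(* If x_j x_i = q x_i x_j for i < j, then x^m x^l = q^(reorder_exp m l) x^(m + l) *)
(* for the ordered monomials x^m = x_1^m_1 ... x_r^m_r.                          *)
Definition reorder_exp m l : nat :=
  (\sum_(i < r) \sum_(j < r | (i < j)%N) m j * l i)%N.

Definition twist_monom a m : S := << a *g m >>.

Definition twist_one : S := twist_monom 1 0.

Definition twist_mul p s : S :=
  \sum_(m <- msupp p) \sum_(l <- msupp s)
    twist_monom (q ^+ reorder_exp m l *: (p@_m * s@_l)) (m + l).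

Lemma reorder_exp0m l : reorder_exp 0 l = 0%N.
Proof. by rewrite /reorder_exp big1 // => i _; rewrite big1 // => j _; rewrite ffunE. Qed.

Lemma reorder_expm0 m : reorder_exp m 0 = 0%N.
Proof.
by rewrite /reorder_exp big1 // => i _; rewrite big1 // => j _; rewrite ffunE muln0.
Qed.

Lemma reorder_expDl m1 m2 l :
  reorder_exp (m1 + m2) l = (reorder_exp m1 l + reorder_exp m2 l)%N.
Proof.
rewrite /reorder_exp -big_split; apply: eq_bigr => i _.
by rewrite -big_split; apply: eq_bigr => j _; rewrite ffunE mulnDl.
Qed.

Lemma reorder_expDr m l1 l2 :
  reorder_exp m (l1 + l2) = (reorder_exp m l1 + reorder_exp m l2)%N.
Proof.
rewrite /reorder_exp -big_split; apply: eq_bigr => i _.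
by rewrite -big_split; apply: eq_bigr => j _; rewrite ffunE mulnDr.
Qed.

Lemma twist0 m : twist_monom 0 m = 0. Proof. exact: monalgU0. Qed.

Lemma twistD m : {morph twist_monom^~ m : a b / a + b}.
Proof. exact: monalgUD. Qed.

Local Notation M p s m l :=
  (twist_monom (q ^+ reorder_exp m l *: (p@_m * s@_l)) (m + l)).

Lemma twist_mulw (d1 d2 : {fset mon}) p s :
    (msupp p `<=` d1)%fset -> (msupp s `<=` d2)%fset ->
  twist_mul p s = \sum_(m <- d1) \sum_(l <- d2) M p s m l.
Proof.
move=> le1 le2; rewrite /twist_mul (big_fset_incl _ le1) /=.
  apply: eq_bigr => m _; apply: big_fset_incl => // l _ /mcoeff_outdom ->.
  by rewrite mulr0 scaler0 twist0.
move=> m _ /mcoeff_outdom pm.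
by rewrite big1 // => l _; rewrite pm mul0r scaler0 twist0.
Qed.

Lemma twist_mulDl : left_distributive twist_mul +%R.
Proof.
move=> p1 p2 s.
rewrite (twist_mulw (msuppD_le _ _) (fsubset_refl _)).
rewrite (twist_mulw (fsubsetUl _ (msupp p2)) (fsubset_refl _)).
rewrite (twist_mulw (fsubsetUr (msupp p1) _) (fsubset_refl _)).
rewrite -big_split /=; apply/eq_bigr => m _.
rewrite -big_split /=; apply/eq_bigr => l _.
by rewrite mcoeffD mulrDl scalerDr twistD.
Qed.

Lemma twist_mulDr : right_distributive twist_mul +%R.
Proof.
move=> s p1 p2.
rewrite (twist_mulw (fsubset_refl _) (msuppD_le _ _)).
rewrite (twist_mulw (fsubset_refl _) (fsubsetUl _ (msupp p2))).
rewrite (twist_mulw (fsubset_refl _) (fsubsetUr (msupp p1) _)).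
rewrite -big_split /=; apply/eq_bigr => m _.
rewrite -big_split /=; apply/eq_bigr => l _.
by rewrite mcoeffD mulrDr scalerDr twistD.
Qed.

Lemma twist_mul0 s : twist_mul 0 s = 0.
Proof. by apply: (addrI (twist_mul 0 s)); rewrite -twist_mulDl !addr0. Qed.

Lemma twist_mulr0 s : twist_mul s 0 = 0.
Proof. by apply: (addrI (twist_mul s 0)); rewrite -twist_mulDr !addr0. Qed.

Lemma twist_mulUU a b m l :
  twist_mul (twist_monom a m) (twist_monom b l)
  = twist_monom (q ^+ reorder_exp m l *: (a * b)) (m + l).
Proof.
by rewrite (twist_mulw msuppU_le msuppU_le) !big_seq_fset1 !mcoeffUU.
Qed.

Lemma twist_suml I (t : seq I) (F : I -> S) s :
  twist_mul (\sum_(i <- t) F i) s = \sum_(i <- t) twist_mul (F i) s.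
Proof.
exact: (big_morph (twist_mul^~ _) (fun _ _ => twist_mulDl _ _ _) (twist_mul0 _)).
Qed.

Lemma twist_sumr I (t : seq I) (F : I -> S) s :
  twist_mul s (\sum_(i <- t) F i) = \sum_(i <- t) twist_mul s (F i).
Proof.
exact: (big_morph (twist_mul _) (fun _ _ => twist_mulDr _ _ _) (twist_mulr0 _)).
Qed.

Lemma twistE p : p = \sum_(m <- msupp p) twist_monom p@_m m.
Proof. exact: monalgE. Qed.

Lemma twist_mulA : associative twist_mul.
Proof.
move=> p1 p2 p3; rewrite [p1]twistE [p2]twistE [p3]twistE.
rewrite !twist_suml; apply: eq_bigr => m1 _.
rewrite [LHS]twist_sumr [X in _ = twist_mul X _]twist_sumr [RHS]twist_suml.
apply: eq_bigr => m2 _.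
rewrite !twist_sumr; apply: eq_bigr => m3 _.
rewrite !twist_mulUU addrA -scalerAr -scalerAl mulrA !scalerA -!exprD.
by congr (twist_monom (q ^+ _ *: _) _); rewrite reorder_expDl reorder_expDr -addnA addnC.
Qed.

Lemma twist_mul1 : left_id twist_one twist_mul.
Proof.
move=> p; rewrite [p in LHS]twistE twist_sumr [RHS]twistE.
apply: eq_bigr => m _.
by rewrite twist_mulUU reorder_exp0m expr0 scale1r mul1r add0r.
Qed.

Lemma twist_mulr1 : right_id twist_one twist_mul.
Proof.
move=> p; rewrite [p in LHS]twistE twist_suml [RHS]twistE.
apply: eq_bigr => m _.
by rewrite twist_mulUU reorder_expm0 expr0 scale1r mulr1 addr0.
Qed.

End TwistedProduct.

(* The algebra generated over L by x_1, ..., x_r, commuting with L and such   *)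
(* that x_j x_i = q x_i x_j for i < j: the free left L-module on the ordered  *)
(* monomials. The operations are locked to keep conversion from unfolding     *)
(* them.                                                                      *)
Record qspace (K : comUnitRingType) (q : K) (L : algType K) (r : nat) :=
  QSpace { qspace_val : {malg L[{ffun 'I_r -> nat}]} }.

HB.instance Definition _ K q L r := [isNew for @qspace_val K q L r].
HB.instance Definition _ K q L r := [Choice of @qspace K q L r by <:].

Section QuantumSpace.
Variables (K : comUnitRingType) (q : K) (L : algType K) (r : nat).
Local Notation S := (qspace q L r).
Local Notation mon := {ffun 'I_r -> nat}.
Implicit Types (p s : S) (m l : mon) (a b : L).
Local Notation v := (@qspace_val K q L r).

Definition qspace_zero : S := locked (QSpace q 0).
Definition qspace_opp : S -> S := locked (fun p => QSpace q (- v p)).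
Definition qspace_add : S -> S -> S := locked (fun p s => QSpace q (v p + v s)).
Definition qspace_one : S := locked (QSpace q (twist_one L r)).
Definition qspace_mul : S -> S -> S :=
  locked (fun p s => QSpace q (twist_mul q (v p) (v s))).
Definition qspace_scale : L -> S -> S :=
  locked (fun a p => QSpace q (a *: v p)).

Let val0 : v qspace_zero = 0.
Proof. by rewrite /qspace_zero -lock. Qed.
Let valN p : v (qspace_opp p) = - v p.
Proof. by rewrite /qspace_opp -lock. Qed.
Let valD p s : v (qspace_add p s) = v p + v s.
Proof. by rewrite /qspace_add -lock. Qed.
Let val1 : v qspace_one = twist_one L r.
Proof. by rewrite /qspace_one -lock. Qed.
Let valM p s : v (qspace_mul p s) = twist_mul q (v p) (v s).
Proof. by rewrite /qspace_mul -lock. Qed.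
Let valZ a p : v (qspace_scale a p) = a *: v p.
Proof. by rewrite /qspace_scale -lock. Qed.
Let v_inj : injective v. Proof. exact: val_inj. Qed.

Fact qspace_addA : associative qspace_add.
Proof. by move=> p s t; apply: v_inj; rewrite !valD addrA. Qed.
Fact qspace_addC : commutative qspace_add.
Proof. by move=> p s; apply: v_inj; rewrite !valD addrC. Qed.
Fact qspace_add0 : left_id qspace_zero qspace_add.
Proof. by move=> p; apply: v_inj; rewrite valD val0 add0r. Qed.
Fact qspace_addN : left_inverse qspace_zero qspace_opp qspace_add.
Proof. by move=> p; apply: v_inj; rewrite valD valN val0 addNr. Qed.

HB.instance Definition _ := GRing.isZmodule.Build (qspace q L r)
  qspace_addA qspace_addC qspace_add0 qspace_addN.

Fact qspace_mulA : associative qspace_mul.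
Proof. by move=> p s t; apply: v_inj; rewrite !valM twist_mulA. Qed.
Fact qspace_mul1 : left_id qspace_one qspace_mul.
Proof. by move=> p; apply: v_inj; rewrite valM val1 twist_mul1. Qed.
Fact qspace_mulr1 : right_id qspace_one qspace_mul.
Proof. by move=> p; apply: v_inj; rewrite valM val1 twist_mulr1. Qed.
Fact qspace_mulDl : left_distributive qspace_mul +%R.
Proof. by move=> p s t; apply: v_inj; rewrite valM !valD !valM twist_mulDl. Qed.
Fact qspace_mulDr : right_distributive qspace_mul +%R.
Proof. by move=> p s t; apply: v_inj; rewrite valM !valD !valM twist_mulDr. Qed.
Fact qspace_one_neq0 : qspace_one != 0.
Proof.
apply/eqP => /(congr1 v) /eqP; rewrite val1 val0.
by rewrite monalgU_eq0 oner_eq0.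
Qed.

HB.instance Definition _ := GRing.Zmodule_isNzRing.Build (qspace q L r)
  qspace_mulA qspace_mul1 qspace_mulr1 qspace_mulDl qspace_mulDr
  qspace_one_neq0.

Fact qspace_scaleA a b p : qspace_scale a (qspace_scale b p) = qspace_scale (a * b) p.
Proof. by apply: v_inj; rewrite !valZ scalerA. Qed.
Fact qspace_scale1 : left_id 1 qspace_scale.
Proof. by move=> p; apply: v_inj; rewrite valZ scale1r. Qed.
Fact qspace_scaleDr : right_distributive qspace_scale +%R.
Proof. by move=> a p s; apply: v_inj; rewrite valZ !valD !valZ scalerDr. Qed.
Fact qspace_scaleDl p : {morph qspace_scale^~ p : a b / a + b}.
Proof. by move=> a b; apply: v_inj; rewrite valD !valZ scalerDl. Qed.

HB.instance Definition _ := GRing.Zmodule_isLmodule.Build L (qspace q L r)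
  qspace_scaleA qspace_scale1 qspace_scaleDr qspace_scaleDl.

Definition qcoef m p : L := (qspace_val p)@_m.

Fact qcoef_is_zmod_morphism m : zmod_morphism (qcoef m).
Proof. by move=> p s; rewrite /qcoef [v _]valD valN mcoeffB. Qed.
HB.instance Definition _ m :=
  GRing.isZmodMorphism.Build S L (qcoef m) (qcoef_is_zmod_morphism m).

Lemma qcoefP p s : (forall m, qcoef m p = qcoef m s) -> p = s.
Proof. by move=> ps; apply: v_inj; apply/malgP. Qed.

Lemma qcoefZ m a p : qcoef m (a *: p) = a * qcoef m p.
Proof. by rewrite /qcoef [v _]valZ mcoeffZ. Qed.

Definition qmonom a m : S := QSpace q << a *g m >>.

Lemma qcoef_monom a m l : qcoef l (qmonom a m) = a *+ (m == l).
Proof. exact: mcoeffU. Qed.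

Lemma qmonom1 : qmonom 1 0 = 1.
Proof. by apply: v_inj; rewrite [v 1]val1. Qed.

Lemma qspaceE p : p = \sum_(m <- msupp (v p)) qmonom (qcoef m p) m.
Proof.
apply: v_inj; rewrite [LHS]monalgE.
by elim/big_rec2: _ => [|m x s _ ->]; [rewrite [v 0]val0|rewrite [v (_ + _)]valD].
Qed.

Lemma qspaceUM a b m l :
  qmonom a m * qmonom b l
  = qmonom (q ^+ reorder_exp m l *: (a * b)) (m + l).
Proof. by apply: v_inj; rewrite [v (_ * _)]valM twist_mulUU. Qed.

Lemma qspace_scaleU a b m : a *: qmonom b m = qmonom (a * b) m.
Proof. by apply: qcoefP => l; rewrite qcoefZ !qcoef_monom mulrnAr. Qed.

Lemma qspace_scaleE a p : a *: p = qmonom a 0 * p.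
Proof.
rewrite [p]qspaceE scaler_sumr mulr_sumr; apply: eq_bigr => m _.
by rewrite qspace_scaleU qspaceUM reorder_exp0m expr0 scale1r add0r.
Qed.

Lemma qspace_scaleAl a p s : a *: (p * s) = (a *: p) * s.
Proof. by rewrite !qspace_scaleE mulrA. Qed.

HB.instance Definition _ := GRing.Lmodule_isLalgebra.Build L (qspace q L r)
  qspace_scaleAl.

Definition qvar (k : 'I_r) : S := qmonom 1 [ffun i => nat_of_bool (i == k)].

Lemma qvarC (i j : 'I_r) : (i < j)%N ->
  qvar j * qvar i = (q%:A : L) *: (qvar i * qvar j).
Proof.
have re (k h : 'I_r) : reorder_exp [ffun i => nat_of_bool (i == k)]
    [ffun i => nat_of_bool (i == h)] = (h < k)%N :> nat.
  rewrite /reorder_exp (bigD1 h) //= [X in (_ + X)%N]big1 ?addn0; last first.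
    by move=> i' /negPf ni; rewrite big1 // => j' _; rewrite !ffunE ni muln0.
  case: ltnP => [lk|kl].
    rewrite (bigD1 k) //= !ffunE !eqxx big1 // => j' /andP[_ /negPf nj].
    by rewrite !ffunE nj.
  rewrite big1 // => j' lj; rewrite !ffunE.
  by case: eqP => // j'k; move: lj; rewrite j'k ltnNge kl.
move=> ij; rewrite !qspaceUM !re ij ltnNge (ltnW ij) /= expr0 expr1 scale1r mulr1.
by rewrite qspace_scaleU mulr1 addrC.
Qed.

Lemma qvar_scalar (k : 'I_r) a : qvar k * a%:A = a *: qvar k.
Proof.
rewrite [a%:A]qspace_scaleE mulr1 qspaceUM reorder_expm0 expr0 scale1r.
by rewrite qspace_scaleU mulr1 mul1r addr0.
Qed.

Lemma qvarX (k : 'I_r) n :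
  qvar k ^+ n = qmonom 1 [ffun i => if i == k then n else 0%N].
Proof.
elim: n => [|n IHn].
  rewrite expr0 -qmonom1; congr (qmonom _ _).
  by apply/ffunP => i; rewrite !ffunE if_same.
rewrite exprS IHn qspaceUM mulr1; set e := reorder_exp _ _.
have -> : e = 0%N.
  rewrite /e /reorder_exp big1 // => i _; rewrite big1 // => j ij.
  rewrite !ffunE; case: eqP => // jk; case: eqP => // ik.
  by move: ij; rewrite jk ik ltnn.
rewrite expr0 scale1r; congr (qmonom _ _); apply/ffunP => i.
by rewrite !ffunE; case: eqP.
Qed.

Lemma qspace_monomialE m : \prod_(i < r) qvar i ^+ m i = qmonom 1 m.
Proof.
pose cut k : mon := [ffun i : 'I_r => if (i < k)%N then m i else 0%N].
have H k (kr : (k <= r)%N) :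
    \prod_(i < k) qvar (widen_ord kr i) ^+ m (widen_ord kr i)
    = qmonom 1 (cut k).
  elim: k kr => [|k IHk] kr.
    by rewrite big_ord0 -qmonom1; congr (qmonom 1 _).
  rewrite big_ord_recr /=.
  have -> : \prod_(i < k) qvar (widen_ord kr (widen_ord (leqnSn k) i)) ^+
      m (widen_ord kr (widen_ord (leqnSn k) i)) = qmonom 1 (cut k).
    rewrite -(IHk (ltnW kr)); apply: eq_bigr => i _.
    by congr (qvar _ ^+ m _); apply: val_inj.
  rewrite qvarX qspaceUM mulr1; set e := reorder_exp _ _.
  have -> : e = 0%N.
    rewrite /e /reorder_exp big1 // => i _; rewrite big1 // => j ij.
    rewrite /cut !ffunE; case: eqP => [ik|]; last by rewrite muln0.
    by rewrite ltnNge ltnW // -(_ : nat_of_ord i = k) // ik.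
  rewrite expr0 scale1r; congr (qmonom _ _); apply/ffunP => i.
  rewrite /cut !ffunE ltnS -val_eqE /= [(i <= k)%N]leq_eqVlt.
  case: (ltngtP i k) => //= ik; rewrite ?add0r ?addr0 //.
  by congr (m _); apply: val_inj.
have := H r (leqnn r); rewrite (_ : cut r = m) => [<-|]; last first.
  by apply/ffunP => i; rewrite /cut ffunE ltn_ord.
by apply: eq_bigr => i _; congr (qvar _ ^+ m _); apply: val_inj.
Qed.

Definition Xrow (A : 'M[L]_r) (i : 'I_r) : S := \sum_(j < r) A i j *: qvar j.

Definition Gcoef (A : 'M[L]_r) m : L := qcoef m (\prod_(i < r) Xrow A i ^+ m i).

End QuantumSpace.

(* The unital associative K-algebra generated by the a_ij modulo the          *)
(* right-quantum relations, presented as formal expressions in the a_ij       *)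
(* modulo the smallest congruence which makes the quotient a K-algebra        *)
(* satisfying these relations.                                                *)
Section RightQuantumTerms.
Variables (K : comUnitRingType) (q : K) (r : nat).

Inductive rq_term : Type :=
| RqConst of K
| RqGen of 'I_r & 'I_r
| RqAdd of rq_term & rq_term
| RqMul of rq_term & rq_term.

HB.instance Definition _ := gen_eqMixin rq_term.
HB.instance Definition _ := gen_choiceMixin rq_term.

Local Notation C := RqConst.
Local Notation a := RqGen.
Local Notation "s [+] t" := (RqAdd s t) (at level 50, left associativity).
Local Notation "s [*] t" := (RqMul s t) (at level 40, left associativity).

Inductive rq_cong : rq_term -> rq_term -> Prop :=
| RqRefl t : rq_cong t t
| RqSym s t : rq_cong s t -> rq_cong t s
| RqTrans s t u : rq_cong s t -> rq_cong t u -> rq_cong s u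
| RqAddCong s s' t t' : rq_cong s s' -> rq_cong t t' -> rq_cong (s [+] t) (s' [+] t')
| RqMulCong s s' t t' : rq_cong s s' -> rq_cong t t' -> rq_cong (s [*] t) (s' [*] t')
| RqAddA s t u : rq_cong (s [+] (t [+] u)) (s [+] t [+] u)
| RqAddC s t : rq_cong (s [+] t) (t [+] s)
| RqAdd0 t : rq_cong (C 0 [+] t) t
| RqMulA s t u : rq_cong (s [*] (t [*] u)) (s [*] t [*] u)
| RqMul1 t : rq_cong (C 1 [*] t) t
| RqMulDl s t u : rq_cong ((s [+] t) [*] u) (s [*] u [+] t [*] u)
| RqMulDr s t u : rq_cong (s [*] (t [+] u)) (s [*] t [+] s [*] u)
| RqConstD c d : rq_cong (C (c + d)) (C c [+] C d)
| RqConstM c d : rq_cong (C (c * d)) (C c [*] C d)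
| RqConstC c t : rq_cong (C c [*] t) (t [*] C c)
| RqMul0 t : rq_cong (C 0 [*] t) (C 0)
| RqColumn (i i' j : 'I_r) : (i < i')%N ->
    rq_cong (a i' j [*] a i j) (C q [*] (a i j [*] a i' j))
| RqCross (i i' j j' : 'I_r) : (i < i')%N -> (j < j')%N ->
    rq_cong (a i j [*] a i' j')
            (a i' j' [*] a i j [+] C q^-1 [*] (a i' j [*] a i j')
             [+] C (- q) [*] (a i j' [*] a i' j)).

Definition rq_equiv : rel rq_term := fun s t => `[< rq_cong s t >].

Lemma rq_equivP s t : reflect (rq_cong s t) (rq_equiv s t).
Proof. exact: asboolP. Qed.

Lemma rq_equiv_is_equiv : equiv_class_of rq_equiv.
Proof.
split=> [s|s t|t s u].
- exact/rq_equivP/RqRefl.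
- by apply/rq_equivP/rq_equivP; exact: RqSym.
- by move=> /rq_equivP st /rq_equivP tu; apply/rq_equivP/(RqTrans st tu).
Qed.

Canonical rq_equiv_equiv := EquivRelPack rq_equiv_is_equiv.
Canonical rq_equiv_encModRel := defaultEncModRel rq_equiv.

Definition rqalg : Type := {eq_quot rq_equiv}.
HB.instance Definition _ := EqQuotient.on rqalg.
HB.instance Definition _ := Choice.on rqalg.

(* [cst] is the structure map of a K-algebra T. *)
Section Eval.
Variables (T : nzRingType) (cst : {rmorphism K -> T}) (A : 'I_r -> 'I_r -> T).

Fixpoint rq_eval (t : rq_term) : T :=
  match t with
  | RqConst c => cst c
  | RqGen i j => A i j
  | RqAdd s t => rq_eval s + rq_eval t
  | RqMul s t => rq_eval s * rq_eval t
  end.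

Hypothesis cst_central : forall c x, cst c * x = x * cst c.
Hypothesis A_column : forall i i' j : 'I_r, (i < i')%N ->
  A i' j * A i j = cst q * (A i j * A i' j).
Hypothesis A_cross : forall i i' j j' : 'I_r, (i < i')%N -> (j < j')%N ->
  A i j * A i' j' = A i' j' * A i j + cst q^-1 * (A i' j * A i j')
                    - cst q * (A i j' * A i' j).

Lemma rq_eval_cong s t : rq_cong s t -> rq_eval s = rq_eval t.
Proof.
elim=> //=; clear s t.
- by move=> s t u _ -> _ ->.
- by move=> s s' t t' _ -> _ ->.
- by move=> s s' t t' _ -> _ ->.
- by move=> s t u; rewrite addrA.
- by move=> s t; rewrite addrC.
- by move=> t; rewrite rmorph0 add0r.
- by move=> s t u; rewrite mulrA.
- by move=> t; rewrite rmorph1 mul1r.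
- by move=> s t u; rewrite mulrDl.
- by move=> s t u; rewrite mulrDr.
- by move=> c d; rewrite rmorphD.
- by move=> c d; rewrite rmorphM.
- by move=> t; rewrite rmorph0 mul0r.
- by move=> i i' j j' ii' jj'; rewrite A_cross // rmorphN mulNr.
Qed.

End Eval.

Local Notation R := rqalg.
Local Notation piR := (\pi_R).

Definition rq_zero : R := lift_cst R (C 0).
Definition rq_one : R := lift_cst R (C 1).
Definition rq_add := lift_op2 R RqAdd.
Definition rq_mul := lift_op2 R RqMul.
Definition rq_opp := lift_op1 R (RqMul (C (- 1))).
Definition rq_const (c : K) : R := lift_cst R (C c).
Definition rq_gen (i j : 'I_r) : R := lift_cst R (a i j).

Lemma rq_piP s t : reflect (piR s = piR t) (rq_equiv s t).
Proof.
by apply: (iffP idP) => [st|/eqP]; [apply/eqP|]; rewrite piE.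
Qed.

Lemma rq_pi_cong s t : rq_cong s t -> piR s = piR t.
Proof. by move=> st; apply/rq_piP/rq_equivP. Qed.

Lemma rq_reprK t : rq_cong (repr (piR t)) t.
Proof. by apply/rq_equivP/rq_piP; rewrite reprK. Qed.

Lemma rq_piD s t : piR (s [+] t) = rq_add (piR s) (piR t).
Proof.
rewrite /rq_add; unlock; apply: rq_pi_cong; apply: RqAddCong; apply: RqSym;
  exact: rq_reprK.
Qed.

Lemma rq_piM s t : piR (s [*] t) = rq_mul (piR s) (piR t).
Proof.
rewrite /rq_mul; unlock; apply: rq_pi_cong; apply: RqMulCong; apply: RqSym;
  exact: rq_reprK.
Qed.

Lemma rq_piN s : piR (C (- 1) [*] s) = rq_opp (piR s).
Proof.
rewrite /rq_opp; unlock; apply: rq_pi_cong; apply: RqMulCong; apply: RqSym;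
  [exact: RqRefl | exact: rq_reprK].
Qed.

Lemma rq_piC c : piR (C c) = rq_const c. Proof. by rewrite /rq_const; unlock. Qed.
Lemma rq_pi0 : piR (C 0) = rq_zero. Proof. by rewrite /rq_zero; unlock. Qed.
Lemma rq_pi1 : piR (C 1) = rq_one. Proof. by rewrite /rq_one; unlock. Qed.
Lemma rq_piG i j : piR (a i j) = rq_gen i j.
Proof. by rewrite /rq_gen; unlock. Qed.

Lemma rq_piW (P : R -> Prop) : (forall t, P (piR t)) -> forall x, P x.
Proof. by move=> H x; rewrite -[x]reprK. Qed.

Let piDM := (rq_piN, rq_pi0, rq_pi1, rq_piC, rq_piD, rq_piM).

Fact rq_addA : associative rq_add.
Proof.
elim/rq_piW => s; elim/rq_piW => t; elim/rq_piW => u.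
by rewrite -!rq_piD; exact/rq_pi_cong/RqAddA.
Qed.
Fact rq_addC : commutative rq_add.
Proof.
elim/rq_piW => s; elim/rq_piW => t.
by rewrite -!rq_piD; exact/rq_pi_cong/RqAddC.
Qed.
Fact rq_add0 : left_id rq_zero rq_add.
Proof.
elim/rq_piW => s; rewrite -rq_pi0 -rq_piD; exact/rq_pi_cong/RqAdd0.
Qed.
Fact rq_addN : left_inverse rq_zero rq_opp rq_add.
Proof.
elim/rq_piW => s; rewrite -rq_pi0 -rq_piN -rq_piD; apply: rq_pi_cong.
apply: (@RqTrans _ (C (- 1) [*] s [+] C 1 [*] s)).
  by apply: RqAddCong; [exact: RqRefl|exact/RqSym/RqMul1].
apply: RqTrans (RqSym (RqMulDl _ _ _)) _.
apply: (@RqTrans _ (C 0 [*] s)); last exact: RqMul0.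
apply: RqMulCong; last exact: RqRefl.
by rewrite -(addNr (1 : K)); exact/RqSym/RqConstD.
Qed.

HB.instance Definition _ := GRing.isZmodule.Build rqalg
  rq_addA rq_addC rq_add0 rq_addN.

Fact rq_mulA : associative rq_mul.
Proof.
elim/rq_piW => s; elim/rq_piW => t; elim/rq_piW => u.
by rewrite -!rq_piM; exact/rq_pi_cong/RqMulA.
Qed.
Fact rq_mul1 : left_id rq_one rq_mul.
Proof.
elim/rq_piW => s; rewrite -rq_pi1 -rq_piM; exact/rq_pi_cong/RqMul1.
Qed.
Fact rq_mulr1 : right_id rq_one rq_mul.
Proof.
elim/rq_piW => s; rewrite -rq_pi1 -rq_piM; apply: rq_pi_cong.
exact: RqTrans (RqSym (RqConstC _ _)) (RqMul1 _).
Qed.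
Fact rq_mulDl : left_distributive rq_mul rq_add.
Proof.
elim/rq_piW => s; elim/rq_piW => t; elim/rq_piW => u.
by rewrite -!rq_piD -!rq_piM -rq_piD; exact/rq_pi_cong/RqMulDl.
Qed.
Fact rq_mulDr : right_distributive rq_mul rq_add.
Proof.
elim/rq_piW => s; elim/rq_piW => t; elim/rq_piW => u.
by rewrite -!rq_piD -!rq_piM -rq_piD; exact/rq_pi_cong/RqMulDr.
Qed.
Fact rq_one_neq0 : rq_one != rq_zero.
Proof.
rewrite -rq_pi0 -rq_pi1; apply/eqP => /rq_piP /rq_equivP.
move=> /(@rq_eval_cong K idfun (fun _ _ => 0)) /= H.
suff /eqP : 1 = 0 :> K by rewrite oner_eq0.
by apply: H => *; rewrite ?(mulr0, mul0r, addr0, subr0) // mulrC.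
Qed.

HB.instance Definition _ := GRing.Zmodule_isNzRing.Build rqalg
  rq_mulA rq_mul1 rq_mulr1 rq_mulDl rq_mulDr rq_one_neq0.

Definition rq_scale (c : K) (x : R) : R := rq_const c * x.

Lemma rq_constM c d : rq_const (c * d) = rq_const c * rq_const d.
Proof. by rewrite -!rq_piC -[RHS]rq_piM; exact/rq_pi_cong/RqConstM. Qed.
Lemma rq_constD c d : rq_const (c + d) = rq_const c + rq_const d.
Proof. by rewrite -!rq_piC -[RHS]rq_piD; exact/rq_pi_cong/RqConstD. Qed.
Lemma rq_const1 : rq_const 1 = 1.
Proof. by rewrite -rq_piC rq_pi1. Qed.
Lemma rq_constC c x : rq_const c * x = x * rq_const c.
Proof.
elim/rq_piW: x => t; rewrite -rq_piC -[LHS]rq_piM -[RHS]rq_piM.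
exact/rq_pi_cong/RqConstC.
Qed.

Fact rq_scaleA c d x : rq_scale c (rq_scale d x) = rq_scale (c * d) x.
Proof. by rewrite /rq_scale rq_constM mulrA. Qed.
Fact rq_scale1 : left_id 1 rq_scale.
Proof. by move=> x; rewrite /rq_scale rq_const1 mul1r. Qed.
Fact rq_scaleDr : right_distributive rq_scale +%R.
Proof. by move=> c x y; rewrite /rq_scale mulrDr. Qed.
Fact rq_scaleDl x : {morph rq_scale^~ x : c d / c + d}.
Proof. by move=> c d; rewrite /rq_scale rq_constD mulrDl. Qed.

HB.instance Definition _ := GRing.Zmodule_isLmodule.Build K rqalg
  rq_scaleA rq_scale1 rq_scaleDr rq_scaleDl.

Fact rq_scaleAl c (x y : R) : c *: (x * y) = (c *: x) * y.
Proof. exact: mulrA. Qed.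

HB.instance Definition _ := GRing.Lmodule_isLalgebra.Build K rqalg rq_scaleAl.

Fact rq_scaleAr c (x y : R) : c *: (x * y) = x * (c *: y).
Proof. by rewrite -[LHS]/(rq_const c * _) mulrA rq_constC -mulrA. Qed.

HB.instance Definition _ := GRing.Lalgebra_isAlgebra.Build K rqalg rq_scaleAr.

Lemma rq_constE c : rq_const c = c%:A.
Proof. by rewrite -[RHS]/(rq_const c * 1) mulr1. Qed.

Definition rq_mx : 'M[rqalg]_r := \matrix_(i, j) rq_gen i j.

Lemma rq_mx_right_quantum : right_quantum q rq_mx.
Proof.
have mE s t : piR s * piR t = piR (s [*] t) by rewrite rq_piM.
have dE s t : piR s + piR t = piR (s [+] t) by rewrite rq_piD.
have zE c t : c *: piR t = piR (C c [*] t) by rewrite rq_piM rq_piC.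
split=> [i i' j ii'|i i' j j' ii' jj']; rewrite !mxE -!rq_piG -?scaleNr !mE.
  by rewrite zE; exact/rq_pi_cong/RqColumn.
by rewrite !zE !dE; exact/rq_pi_cong/RqCross.
Qed.

Lemma rqalg_ind (P : rqalg -> Prop) :
    (forall c, P c%:A) -> (forall i j, P (rq_gen i j)) ->
    (forall x y, P x -> P y -> P (x + y)) ->
    (forall x y, P x -> P y -> P (x * y)) ->
  forall x, P x.
Proof.
move=> PC PG PD PM; elim/rq_piW; elim=> [c|i j|s Ps t Pt|s Ps t Pt].
- by rewrite rq_piC rq_constE.
- by rewrite rq_piG.
- by rewrite rq_piD; exact: PD.
- by rewrite rq_piM; exact: PM.
Qed.

Section Lift.
Variables (T : nzRingType) (cst : {rmorphism K -> T}) (A : 'I_r -> 'I_r -> T).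
Hypothesis cst_central : forall c x, cst c * x = x * cst c.
Hypothesis A_column : forall i i' j : 'I_r, (i < i')%N ->
  A i' j * A i j = cst q * (A i j * A i' j).
Hypothesis A_cross : forall i i' j j' : 'I_r, (i < i')%N -> (j < j')%N ->
  A i j * A i' j' = A i' j' * A i j + cst q^-1 * (A i' j * A i j')
                    - cst q * (A i j' * A i' j).

Lemma rq_lift : { f : {rmorphism rqalg -> T} |
  (forall c, f c%:A = cst c) /\ (forall i j, f (rq_gen i j) = A i j) }.
Proof.
pose f (x : rqalg) := rq_eval cst A (repr x).
have fE t : f (piR t) = rq_eval cst A t.
  by apply: rq_eval_cong => //; exact: rq_reprK.
have fB : zmod_morphism f.
  elim/rq_piW => s; elim/rq_piW => t.
  rewrite -[- _]rq_piN -[_ + _]rq_piD !fE /=.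
  by rewrite rmorphN rmorph1 mulN1r.
have fM : monoid_morphism f.
  split; first by rewrite -[1]rq_pi1 fE /= rmorph1.
  by elim/rq_piW => s; elim/rq_piW => t; rewrite -[_ * _]rq_piM !fE.
pose fz := GRing.isZmodMorphism.Build _ _ f fB.
pose fm := GRing.isMonoidMorphism.Build _ _ f fM.
pose F : {rmorphism rqalg -> T} := HB.pack f fz fm.
exists F; split=> [c|i j]; rewrite -[LHS]/(f _).
  by rewrite -rq_constE -rq_piC fE.
by rewrite -rq_piG fE.
Qed.

End Lift.

End RightQuantumTerms.

Section Grading.
Variables (K : comUnitRingType) (q : K) (r : nat).
Local Notation R := (rqalg q r).

(* [rq_homog n] is the component R_n of degree n, each a_ij having degree 1. *)
Inductive rq_homog : nat -> R -> Prop :=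
| RqHomogScalar c : rq_homog 0 c%:A
| RqHomogGen i j : rq_homog 1 (rq_gen q i j)
| RqHomog0 n : rq_homog n 0
| RqHomogD n x y : rq_homog n x -> rq_homog n y -> rq_homog n (x + y)
| RqHomogM m n x y : rq_homog m x -> rq_homog n y -> rq_homog (m + n) (x * y).

Lemma rq_homogZ n c x : rq_homog n x -> rq_homog n (c *: x).
Proof.
by move=> hx; rewrite -mulr_algl -[n]add0n; apply: RqHomogM => //; constructor.
Qed.

Lemma rq_homogN n x : rq_homog n x -> rq_homog n (- x).
Proof. by rewrite -scaleN1r; exact: rq_homogZ. Qed.

Lemma rq_homog1 : rq_homog 0 1.
Proof. by rewrite -(scale1r 1); constructor. Qed.

Lemma rq_homog_sum n I (t : seq I) (P : pred I) (F : I -> R) :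
  (forall i, P i -> rq_homog n (F i)) -> rq_homog n (\sum_(i <- t | P i) F i).
Proof. by move=> hF; apply: big_ind => //; [exact: RqHomog0 | exact: RqHomogD]. Qed.

Let cstX : K -> {poly R} := fun c => (c%:A)%:P.

Let cstX_zmod : zmod_morphism cstX.
Proof. by move=> c d; rewrite /cstX scalerBl polyCB. Qed.
Let cstX_monoid : monoid_morphism cstX.
Proof.
split; rewrite /cstX; first by rewrite scale1r.
by move=> c d; rewrite -polyCM -scalerAl mul1r scalerA.
Qed.
Let cstXm : {rmorphism K -> {poly R}} :=
  HB.pack cstX (GRing.isZmodMorphism.Build _ _ cstX cstX_zmod)
               (GRing.isMonoidMorphism.Build _ _ cstX cstX_monoid).

Let cstX_central c (p : {poly R}) : cstXm c * p = p * cstXm c.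
Proof.
apply/polyP => n; rewrite coefCM coefMC.
by rewrite -scalerAl mul1r -scalerAr mulr1.
Qed.

Let monomX (x y : R) : (x *: 'X) * (y *: 'X) = (x * y) *: 'X^2.
Proof. by rewrite -scalerAl -commr_polyX -scalerAl scalerA. Qed.

Let cstXE c (x : R) (p : {poly R}) : cstXm c * (x *: p) = (c *: x) *: p.
Proof. by rewrite mul_polyC scalerA mulr_algl. Qed.

Let rq_grade_pkg : { f : {rmorphism R -> {poly R}} |
  (forall c, f c%:A = (c%:A)%:P) /\ (forall i j, f (rq_gen q i j) = rq_gen q i j *: 'X) }.
Proof.
have [col cross] := @rq_mx_right_quantum K q r.
apply: (@rq_lift K q r _ cstXm (fun i j => rq_gen q i j *: 'X)).
- exact: cstX_central.
- move=> i i' j ii'; rewrite !monomX cstXE.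
  by have := col i i' j ii'; rewrite !mxE => ->.
- move=> i i' j j' ii' jj'; rewrite !monomX !cstXE -scalerDl -scalerBl.
  by have := cross i i' j j' ii' jj'; rewrite !mxE => ->.
Qed.

(* The ring morphism R -> R[X] mapping a_ij to a_ij X: its coefficients are   *)
(* the homogeneous components.                                                *)
Definition rq_grade : {rmorphism R -> {poly R}} := sval rq_grade_pkg.
Definition rq_comp n (x : R) : R := (rq_grade x)`_n.

Lemma rq_grade_scalar c : rq_grade c%:A = (c%:A)%:P.
Proof. exact: (svalP rq_grade_pkg).1. Qed.

Lemma rq_grade_gen i j : rq_grade (rq_gen q i j) = rq_gen q i j *: 'X.
Proof. exact: (svalP rq_grade_pkg).2. Qed.

Lemma rq_comp_is_zmod_morphism n : zmod_morphism (rq_comp n).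
Proof. by move=> x y; rewrite /rq_comp raddfB coefB. Qed.
HB.instance Definition _ n :=
  GRing.isZmodMorphism.Build R R (rq_comp n) (rq_comp_is_zmod_morphism n).

Lemma rq_compM n x y :
  rq_comp n (x * y) = \sum_(k < n.+1) rq_comp k x * rq_comp (n - k) y.
Proof. by rewrite /rq_comp rmorphM coefM. Qed.

Lemma rq_comp_homog n x : rq_homog n (rq_comp n x).
Proof.
elim/rqalg_ind: x n => [c|i j|x y hx hy|x y hx hy] n.
- rewrite /rq_comp rq_grade_scalar coefC; case: eqP => [->|_]; constructor.
- rewrite /rq_comp rq_grade_gen coefZ coefX; case: eqP => [->|_].
    by rewrite mulr1; constructor.
  by rewrite mulr0; constructor.
- by rewrite raddfD; exact: RqHomogD.
- rewrite rq_compM; apply: rq_homog_sum => k _.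
  by rewrite -[n in rq_homog n](@subnKC k n) ?leq_ord //; exact: RqHomogM.
Qed.

Lemma rq_grade_homog n x : rq_homog n x -> rq_grade x = x *: 'X^n.
Proof.
elim=> {n x} [c|i j|n|n x y _ hx _ hy|m n x y _ hx _ hy].
- by rewrite rq_grade_scalar expr0 alg_polyC.
- by rewrite rq_grade_gen expr1.
- by rewrite raddf0 scale0r.
- by rewrite raddfD scalerDl /= hx hy.
- rewrite rmorphM /= hx hy -scalerAl -commr_polyXn -scalerAl scalerA.
  by rewrite -exprD addnC.
Qed.

Lemma rq_compE m n x : rq_homog n x -> rq_comp m x = x *+ (m == n).
Proof. by move=> hx; rewrite /rq_comp (rq_grade_homog hx) coefZ coefXn mulr_natr. Qed.

Lemma rq_comp_sum x : exists N, x = \sum_(n < N) rq_comp n x.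
Proof.
exists (size (rq_grade x)); transitivity (rq_grade x).[1]; last first.
  by rewrite horner_coef; apply: eq_bigr => n _; rewrite expr1n mulr1.
elim/rqalg_ind: x => [c|i j|x y hx hy|x y hx hy].
- by rewrite rq_grade_scalar hornerC.
- by rewrite rq_grade_gen hornerZ hornerX mulr1.
- by rewrite raddfD /= hornerD -hx -hy.
- rewrite rmorphM /= hornerM_comm -?hx -?hy //.
  by rewrite /comm_poly mulr1 mul1r.
Qed.

End Grading.

(* The completion of R with respect to its grading, i.e. the product of the   *)
(* R_n, with the Cauchy product.                                              *)
Record completion (K : comUnitRingType) (q : K) (r : nat) := Completion {
  hcomp : nat -> rqalg q r;
  hcomp_homog : forall n, rq_homog n (hcomp n) }.

Arguments hcomp {K q r} _ _.

HB.instance Definition _ K q r := gen_eqMixin (@completion K q r).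
HB.instance Definition _ K q r := gen_choiceMixin (@completion K q r).

Section Completion.
Variables (K : comUnitRingType) (q : K) (r : nat).
Local Notation R := (rqalg q r).
Local Notation Rhat := (completion q r).
Implicit Types f g h : Rhat.

Lemma completionP f g : (forall n, hcomp f n = hcomp g n) -> f = g.
Proof.
case: f g => [f hf] [g hg] /= /funext fg; rewrite fg in hf *.
by congr Completion; exact: Prop_irrelevance.
Qed.

Definition hzero : Rhat := Completion (fun n => RqHomog0 q r n).
Definition hopp f : Rhat := Completion (fun n => rq_homogN (hcomp_homog f n)).
Definition hadd f g : Rhat :=
  Completion (fun n => RqHomogD (hcomp_homog f n) (hcomp_homog g n)).

Fact hone_subproof n : rq_homog n (if n == 0%N then 1 else 0 : R).
Proof. by case: eqP => [->|_]; [exact: rq_homog1 | exact: RqHomog0]. Qed.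
Definition hone : Rhat := Completion hone_subproof.

Fact hmul_subproof f g n :
  rq_homog n (\sum_(k < n.+1) hcomp f k * hcomp g (n - k)).
Proof.
apply: rq_homog_sum => k _.
rewrite -[n in rq_homog n](@subnKC k n) ?leq_ord //.
by apply: RqHomogM; exact: hcomp_homog.
Qed.
Definition hmul f g : Rhat := Completion (hmul_subproof f g).

Fact haddA : associative hadd.
Proof. by move=> f g h; apply: completionP => n /=; rewrite addrA. Qed.
Fact haddC : commutative hadd.
Proof. by move=> f g; apply: completionP => n /=; rewrite addrC. Qed.
Fact hadd0 : left_id hzero hadd.
Proof. by move=> f; apply: completionP => n /=; rewrite add0r. Qed.
Fact haddN : left_inverse hzero hopp hadd.
Proof. by move=> f; apply: completionP => n /=; rewrite addNr. Qed.

HB.instance Definition _ := GRing.isZmodule.Build (completion q r)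
  haddA haddC hadd0 haddN.

Fact hcomp_mul f g n :
  hcomp (hmul f g) n = \sum_(k < n.+1) hcomp f k * hcomp g (n - k).
Proof. by []. Qed.

Fact hcomp_mul_rev f g n :
  hcomp (hmul f g) n = \sum_(k < n.+1) hcomp f (n - k) * hcomp g k.
Proof.
rewrite /= (reindex_inj rev_ord_inj) /=.
by apply: eq_bigr => k _; rewrite (sub_ordK k).
Qed.

Fact hmulA : associative hmul.
Proof.
move=> f g h; apply: completionP => n; rewrite [RHS]hcomp_mul_rev hcomp_mul.
pose c3 j k := hcomp f j * (hcomp g (n - j - k) * hcomp h k).
transitivity (\sum_(j < n.+1) \sum_(k < n.+1 | (k <= n - j)%N) c3 j k).
  apply: eq_bigr => j _; rewrite hcomp_mul_rev big_distrr /=.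
  by rewrite (big_ord_narrow_leq (leq_subr _ _)).
rewrite (exchange_big_dep predT) //; apply: eq_bigr => k _.
transitivity (\sum_(j < n.+1 | (j <= n - k)%N) c3 j k).
  apply: eq_bigl => j; rewrite -ltnS -(ltnS j) -!subSn ?leq_ord //.
  by rewrite -subn_gt0 -(subn_gt0 j) -!subnDA addnC.
rewrite (big_ord_narrow_leq (leq_subr _ _)) hcomp_mul big_distrl /=.
by apply: eq_bigr => j _; rewrite /c3 -!subnDA addnC mulrA.
Qed.

Fact hmul1 : left_id hone hmul.
Proof.
move=> f; apply: completionP => n /=.
by rewrite big_ord_recl /= subn0 mul1r big1 ?addr0 // => k _; rewrite mul0r.
Qed.
Fact hmulr1 : right_id hone hmul.
Proof.
move=> f; apply: completionP => n; rewrite hcomp_mul_rev.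
by rewrite big_ord_recl /= subn0 mulr1 big1 ?addr0 // => k _; rewrite mulr0.
Qed.
Fact hmulDl : left_distributive hmul hadd.
Proof.
move=> f g h; apply: completionP => n /=; rewrite -big_split.
by apply: eq_bigr => k _; rewrite mulrDl.
Qed.
Fact hmulDr : right_distributive hmul hadd.
Proof.
move=> f g h; apply: completionP => n /=; rewrite -big_split.
by apply: eq_bigr => k _; rewrite mulrDr.
Qed.
Fact hone_neq0 : hone != hzero.
Proof.
by apply/eqP => /(congr1 (hcomp^~ 0%N)) /= /eqP; rewrite oner_eq0.
Qed.

HB.instance Definition _ := GRing.Zmodule_isNzRing.Build (completion q r)
  hmulA hmul1 hmulr1 hmulDl hmulDr hone_neq0.

Lemma hcompM f g n :
  hcomp (f * g) n = \sum_(k < n.+1) hcomp f k * hcomp g (n - k).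
Proof. by []. Qed.

Lemma hcomp1 n : hcomp (1 : Rhat) n = (n == 0%N)%:R.
Proof. by rewrite /=; case: eqP. Qed.

Lemma hcomp_is_zmod_morphism n : zmod_morphism (hcomp^~ n : Rhat -> R).
Proof. by []. Qed.

(* The inverse is the two-sided inverse of the elements having one. *)
Definition hunit_prop f : Prop := exists g, g * f = 1 /\ f * g = 1.
Definition hunit : pred Rhat := fun f => `[< hunit_prop f >].
Definition hinv f : Rhat :=
  if pselect (hunit_prop f) is left fU then sval (cid fU) else f.

Fact hmulV : {in hunit, left_inverse 1 hinv *%R}.
Proof.
move=> f /asboolP fU; rewrite /hinv; case: pselect => // fU'.
by have [] := svalP (cid fU').
Qed.
Fact hdivV : {in hunit, right_inverse 1 hinv *%R}.
Proof.
move=> f /asboolP fU; rewrite /hinv; case: pselect => // fU'.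
by have [] := svalP (cid fU').
Qed.
Fact hunitP f g : g * f = 1 /\ f * g = 1 -> f \in hunit.
Proof. by move=> gf; apply/asboolP; exists g. Qed.
Fact hinv_out : {in [predC hunit], hinv =1 id}.
Proof.
move=> f /negP fU; rewrite /hinv; case: pselect => // fU'.
by case: fU; apply/asboolP.
Qed.

HB.instance Definition _ := GRing.NzRing_hasMulInverse.Build (completion q r)
  hmulV hdivV hunitP hinv_out.

(* The canonical map from R to its completion. *)
Definition to_completion (x : R) : Rhat :=
  Completion (fun n => rq_comp_homog n x).

Lemma to_completion_is_zmod_morphism : zmod_morphism to_completion.
Proof. by move=> x y; apply: completionP => n /=; rewrite raddfB. Qed.
HB.instance Definition _ :=
  GRing.isZmodMorphism.Build R Rhat to_completion to_completion_is_zmod_morphism.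

Lemma to_completion_is_monoid_morphism : monoid_morphism to_completion.
Proof.
split=> [|x y]; apply: completionP => n; last exact: rq_compM.
by rewrite hcomp1 /= (rq_compE _ (rq_homog1 _ _)) -mulr_natr mul1r.
Qed.
HB.instance Definition _ :=
  GRing.isMonoidMorphism.Build R Rhat to_completion
    to_completion_is_monoid_morphism.

Lemma to_completion_inj : injective to_completion.
Proof.
apply: raddf_inj => x x0; have [N ->] := rq_comp_sum x.
by apply: big1 => n _; have /(congr1 (hcomp^~ n)) := x0.
Qed.

(* Convergence in the product of the discrete R_n. *)
Definition summable (I : choiceType) (F : I -> Rhat) : Prop :=
  forall n, finite_set [set i | hcomp (F i) n != 0].

Fact hsum_subproof (I : choiceType) (F : I -> Rhat) n :
  rq_homog n (\sum_(i \in [set: I]) hcomp (F i) n).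
Proof. by apply: rq_homog_sum => i _; exact: hcomp_homog. Qed.

(* A finite sum in each degree as soon as F is summable (and 0 in the degrees *)
(* where infinitely many components do not vanish).                           *)
Definition hsum (I : choiceType) (F : I -> Rhat) : Rhat :=
  Completion (hsum_subproof F).

(* Meant for A = [rq_mx q r], for which the family is summable. *)
Definition Bos (A : 'M[R]_r) : Rhat :=
  hsum (fun m : {ffun 'I_r -> nat} => to_completion (Gcoef q A m)).

Lemma Gcoef_homog (m : {ffun 'I_r -> nat}) :
  rq_homog (\sum_(i < r) m i) (Gcoef q (rq_mx q r) m).
Proof.
pose H d (p : qspace q R r) := forall l, rq_homog d (qcoef l p).
have H1 : H 0%N 1.
  by move=> l; rewrite -qmonom1 qcoef_monom; case: eqP => _;
    [exact: rq_homog1 | exact: RqHomog0].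
have HM d e p s : H d p -> H e s -> H (d + e)%N (p * s).
  move=> hp hs l; rewrite [p]qspaceE [s]qspaceE mulr_suml raddf_sum.
  apply: rq_homog_sum => k _; rewrite mulr_sumr raddf_sum.
  apply: rq_homog_sum => k' _; rewrite /= qspaceUM qcoef_monom.
  case: eqP => _; last exact: RqHomog0.
  by apply: rq_homogZ; apply: RqHomogM; [exact: hp | exact: hs].
have HX i : H 1%N (Xrow q (rq_mx q r) i).
  move=> l; rewrite raddf_sum; apply: rq_homog_sum => j _ /=.
  rewrite mxE qspace_scaleU mulr1 qcoef_monom.
  by case: eqP => _; [exact: RqHomogGen | exact: RqHomog0].
have HXn i n : H n (Xrow q (rq_mx q r) i ^+ n).
  by elim: n => [|n IHn] //; rewrite exprS -add1n; exact: HM.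
suff : H (\sum_(i < r) m i)%N (\prod_(i < r) Xrow q (rq_mx q r) i ^+ m i) by apply.
by elim/big_rec2: _ => // i d p _ hp; exact: HM.
Qed.

Lemma Bos_summable :
  summable (fun m : {ffun 'I_r -> nat} => to_completion (Gcoef q (rq_mx q r) m)).
Proof.
move=> n; pose E := [set [ffun i => nat_of_ord (f i)] | f in
  [set: {ffun 'I_r -> 'I_n.+1}]]%classic.
apply: (@sub_finite_set _ _ E); last exact: finite_image.
move=> m /=; rewrite (rq_compE _ (Gcoef_homog m)).
have [nE _|_] := eqVneq n; last by rewrite mulr0n eqxx.
have mn i : (m i < n.+1)%N by rewrite ltnS nE (bigD1 i) //= leq_addr.
by exists [ffun i => Ordinal (mn i)] => //; apply/ffunP => i; rewrite !ffunE.
Qed.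

End Completion.

(* Main.v *)
(* On the q-polynomials times the q-exterior algebra (e_i e_i = 0,             *)
(* e_k e_i = (- q)^-1 e_i e_k for i < k), put X_i = sum_j a_ij x_j and          *)
(* Omega_j = sum_i a_ij e_i. The right-quantum relations say exactly that the   *)
(* X_i satisfy the relations of the x_i, or the Omega_j those of the e_j. Let   *)
(* T be the matrix of coefficients of x^l e_I in X^m Omega_J, viewed as acting  *)
(* from the pairs (m, I) to the pairs (l, J). Since sum_i X_i e_i =             *)
(* sum_j x_j Omega_j, T commutes with the Koszul differential, which has        *)
(* entries in K and is contractible over K in positive degree. Hence T has      *)
(* supertrace 0 there. The diagonal entries of T are the products               *)
(* G(m) det_q(A_J), so Bos(A) Ferm(A) = 1.                                      *)

Require Import Defs.
From mathcomp Require Import classical_sets fsbigop.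
From mathcomp Require Import all_boot all_algebra perm finmap monalg.

Set Implicit Arguments.
Unset Strict Implicit.
Unset Printing Implicit Defensive.

Import GRing.Theory.
Local Open Scope ring_scope.

(** The mechanism is the one behind the classical relation between traces of symmetric and exterior
    powers: a supertrace vanishes on a contractible Koszul complex. The degree n component of Bos(A)
    Ferm(A) is the sum of (-1)^|J| G(m) det_q(A_J) over all pairs with |m| + |J| = n, that is, the
    supertrace of [ktrans] on the span of [kbasis r n].

    The right-quantum relations enter twice. They make the X_i q-commute like the x_i ([Xrow_comm],
    hence [Gmx_Xrow]), and they make the Omega_j multiply like the e_j ([col_wedge_sqr] and
    [col_wedge_comm], hence [col_wedge_minor]). Together these give [ktrans_diff]: [ktrans] commutes
    with the Koszul differential. For n > 0 an explicit homotopy contracts the complex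
    ([khomotopyP]). Differential and homotopy have entries in K, so cyclicity of the trace may be
    applied to them although the entries of [ktrans] do not commute ([supertrace_eq0]). [minor_diag]
    recognizes the diagonal minors as quantum determinants.

    This yields the one-sided identity [Bos_mul_Ferm]; since Bos(A) has constant term 1, it is
    itself invertible, and [completion_rinv_unit] turns the identity into a two-sided one. *)

(** * Supertraces on contractible complexes *)

Lemma big_seq_pred1 (V : nmodType) (I : eqType) (s : seq I) (x : I) (F : I -> V) :
  uniq s -> \sum_(i <- s | i == x) F i = if x \in s then F x else 0.
Proof.
move=> us; case: ifP => xs.
  by rewrite big_mkcond (bigD1_seq x) //= eqxx big1 ?addr0 // => i /negPf->.
by rewrite big1_seq // => i /andP[/eqP-> ]; rewrite xs.
Qed.

(** Insert 1 = DH + HD into the supertrace of T. Moving D across T and then around the trace turns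
    the DH part into minus the HD part, since D is odd for [sgn]. Only entries of D and H, which are
    central, change places with those of T. *)
Lemma supertrace_eq0 (K : comNzRingType) (L : algType K) (V : eqType) (s : seq V)
    (T : V -> V -> L) (D H : V -> V -> K) (sgn : V -> K) :
    uniq s ->
    {in s &, forall u w, \sum_(v <- s) D u v *: T v w = \sum_(v <- s) D v w *: T u v} ->
    {in s &, forall u w, \sum_(v <- s) (D u v * H v w + H u v * D v w) = (u == w)%:R} ->
    (forall u v, sgn u * D u v = - (sgn v * D u v)) ->
  \sum_(u <- s) sgn u *: T u u = 0.
Proof.
move=> us DT DH sgnD.
transitivity (\sum_(u <- s) \sum_(v <- s) \sum_(w <- s)
    (sgn u * (D v w * H w u + H v w * D w u)) *: T u v).
  rewrite big_seq_cond [RHS]big_seq_cond; apply: eq_bigr => u /andP[su _].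
  transitivity (\sum_(v <- s) (v == u)%:R *: (sgn u *: T u v)).
    rewrite (bigD1_seq u) //= eqxx scale1r big1 ?addr0 // => v /negPf->.
    by rewrite scale0r.
  rewrite big_seq_cond [RHS]big_seq_cond; apply: eq_bigr => v /andP[sv _].
  by rewrite -DH // -scaler_suml -mulr_sumr scalerA mulrC.
under eq_bigr do under eq_bigr do under eq_bigr do rewrite mulrDr scalerDl.
under eq_bigr do under eq_bigr do rewrite big_split.
under eq_bigr do rewrite big_split.
rewrite big_split /= [X in X + _](_ : _ =
  \sum_(u <- s) \sum_(v <- s) \sum_(w <- s) (sgn u * D u v * H w u) *: T v w).
  rewrite [X in _ + X](_ : _ =
    \sum_(u <- s) \sum_(v <- s) \sum_(w <- s) (sgn v * H w u * D u v) *: T v w).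
    rewrite -big_split big1 //= => u _; rewrite -big_split big1 //= => v _.
    rewrite -big_split big1 //= => w _.
    by rewrite -scalerDl sgnD mulNr mulrAC addNr scale0r.
  under eq_bigr do rewrite exchange_big /=.
  rewrite exchange_big; apply: eq_bigr => w _; apply: eq_bigr => u _.
  by apply: eq_bigr => v _; rewrite mulrA.
rewrite big_seq_cond [RHS]big_seq_cond; apply: eq_bigr => u /andP[su _].
rewrite exchange_big [RHS]exchange_big.
rewrite big_seq_cond [RHS]big_seq_cond; apply: eq_bigr => w /andP[sw _].
transitivity ((sgn u * H w u) *: \sum_(v <- s) D v w *: T u v).
  rewrite scaler_sumr; apply: eq_bigr => v _.
  by rewrite scalerA -mulrA [H _ _ * _]mulrC.
rewrite -DT // scaler_sumr; apply: eq_bigr => v _.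
by rewrite scalerA mulrAC.
Qed.

(** * Inverses in the completion *)

Section CompletionUnits.
Variables (K : comUnitRingType) (q : K) (r : nat).
Local Notation Rhat := (completion q r).
Implicit Types f g h : Rhat.

Lemma hcompB f g n : hcomp (f - g) n = hcomp f n - hcomp g n.
Proof. by []. Qed.

Lemma hcomp_sum (I : Type) (t : seq I) (P : pred I) (F : I -> Rhat) n :
  hcomp (\sum_(i <- t | P i) F i) n = \sum_(i <- t | P i) hcomp (F i) n.
Proof. exact: (big_morph (fun f => hcomp f n)). Qed.

Lemma hcompX_lt h k n : hcomp h 0 = 0 -> (n < k)%N -> hcomp (h ^+ k) n = 0.
Proof.
move=> h0; elim: k n => // k IHk n nk; rewrite exprS hcompM big_ord_recl h0 mul0r add0r.
by rewrite big1 // => i _; rewrite IHk ?mulr0 // lift0; case: n nk i => [|n] nk [] //= i _;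
  rewrite subSS (leq_ltn_trans (leq_subr _ _)).
Qed.

(** Geometric series in h = 1 - f: powers of h beyond the n-th vanish up to degree n, so the degree
    n component can be read off the partial sum [sh n]. *)
Lemma completion_linv f : hcomp f 0 = 1 -> exists g, g * f = 1.
Proof.
move=> f0; pose h := 1 - f; pose sh n := \sum_(k < n.+1) h ^+ k.
have h0 : hcomp h 0 = 0 by rewrite hcompB f0 subrr.
have fE : f = 1 - h by rewrite /h opprB addrC subrK.
clearbody h; exists (Completion (fun n => hcomp_homog (sh n) n)); apply: completionP => n.
transitivity (hcomp (sh n * f) n).
  rewrite !hcompM; apply: eq_bigr => k _; congr (_ * _) => /=.
  rewrite /sh !hcomp_sum.
  rewrite (big_ord_widen _ (fun i => hcomp (h ^+ i) k) (ltn_ord k)).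
  rewrite [RHS](bigID (fun i : 'I_n.+1 => (i < k.+1)%N)) /= [X in _ + X]big1 ?addr0 //.
  by move=> i; rewrite -leqNgt; exact: hcompX_lt.
have -> : sh n * f = 1 - h ^+ n.+1.
  rewrite [f in LHS]fE -[RHS]opprB subrX1 -mulNr opprB mulr_suml mulr_sumr; apply: eq_bigr => k _.
  by rewrite mulrBr mulrBl mulr1 mul1r -exprSr exprS.
by rewrite hcompB (hcompX_lt h0 (ltnSn n)) subr0.
Qed.

(** A left inverse of g must coincide with its right inverse f, so f and g are inverse on both
    sides. *)
Lemma completion_rinv_unit f g :
  hcomp g 0 = 1 -> g * f = 1 -> f \is a GRing.unit /\ g = f^-1.
Proof.
move=> /completion_linv[c cg] gf; have cf : c = f by rewrite -[c]mulr1 -gf mulrA cg mul1r.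
have fu : f \is a GRing.unit by apply/unitrP; exists g; rewrite gf -cf cg.
by split=> //; rewrite -[g]mulr1 -(divrr fu) mulrA gf mul1r.
Qed.

End CompletionUnits.

(** * The polynomial side: q-commutation of the X_i *)

Lemma sorted_enum_ord n : sorted (fun i j : 'I_n => i < j)%N (enum 'I_n).
Proof. by rewrite -(@sorted_map _ _ val ltn) val_enum_ord iota_ltn_sorted. Qed.

Lemma sum_ord_pairs (V : nmodType) n (F : 'I_n -> 'I_n -> V) :
  \sum_i \sum_j F i j =
  \sum_(i < n) \sum_(j < n)
    (if (i < j)%N then F i j + F j i else if i == j :> nat then F i i else 0).
Proof.
transitivity (\sum_(i < n) \sum_(j < n) ((if (i < j)%N then F i j else 0) +
  (if (j < i)%N then F i j else 0) + (if i == j :> nat then F i i else 0))).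
  apply: eq_bigr => i _; apply: eq_bigr => j _.
  by case: ltngtP => [||/val_inj->]; rewrite ?addr0 ?add0r.
under eq_bigr do rewrite !big_split /=.
rewrite !big_split /= [X in _ + X + _]exchange_big -!big_split; apply: eq_bigr => i _ /=.
rewrite -!big_split; apply: eq_bigr => j _ /=.
by case: ltngtP => _; rewrite ?addr0 ?add0r.
Qed.

Section Boson.
Variables (K : comUnitRingType) (q : K) (L : algType K) (r : nat).
Local Notation mon := {ffun 'I_r -> nat}.
Local Notation S := (qspace q L r).
Implicit Types (i j : 'I_r) (m l : mon) (A : 'M[L]_r) (p s : S).

Definition mon_incr i m : mon := [ffun j => (m j + (j == i))%N].
Definition mon_decr i m : mon := [ffun j => (m j - (j == i))%N].

Definition mon_above i m : nat := (\sum_(j < r | (i < j)%N) m j)%N.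

Lemma mon_incrK i m : mon_decr i (mon_incr i m) = m.
Proof. by apply/ffunP => j; rewrite !ffunE addnK. Qed.

Lemma mon_decrK i m : (0 < m i)%N -> mon_incr i (mon_decr i m) = m.
Proof.
by move=> mi; apply/ffunP => j; rewrite !ffunE; case: eqP => [->|_]; rewrite ?subnK ?subn0 ?addn0.
Qed.

Lemma mon_incrE i m : m + [ffun j => nat_of_bool (j == i)] = mon_incr i m.
Proof. by apply/ffunP => j; rewrite !ffunE. Qed.

Lemma qcoef_Zvar (a : L) p j l : qcoef l (p * (a *: qvar q L j)) = qcoef l (p * qvar q L j) * a.
Proof.
rewrite [p]qspaceE !mulr_suml !raddf_sum mulr_suml; apply: eq_bigr => m _ /=.
rewrite qspace_scaleU !qspaceUM !qcoef_monom !mulr1.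
by rewrite mulrnAl -scalerAl.
Qed.

Lemma qcoef_var p j l :
  qcoef l (p * qvar q L j) =
  if (0 < l j)%N then q ^+ mon_above j (mon_decr j l) *: qcoef (mon_decr j l) p else 0.
Proof.
rewrite [p]qspaceE mulr_suml !raddf_sum /=.
under eq_bigr => m _ do rewrite qspaceUM qcoef_monom mulr1.
case: ifP => lj; last first.
  apply: big1 => m _; case: eqP => // ml; move: lj.
  by rewrite -ml mon_incrE ffunE eqxx addn1.
apply: eq_bigr => m _; rewrite qcoef_monom.
have -> : (m + [ffun i => nat_of_bool (i == j)] == l) = (m == mon_decr j l).
  by rewrite mon_incrE; apply/eqP/eqP => [<-|->]; rewrite (mon_incrK, mon_decrK).
case: eqP => [->|_]; last by rewrite !mulr0n scaler0.
congr (q ^+ _ *: _); rewrite /reorder_exp (bigD1 j) //= [X in (_ + X)%N]big1 ?addn0.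
  by apply: eq_bigr => i _; rewrite [X in (_ * X)%N]ffunE eqxx muln1.
by move=> i /negPf ij; rewrite big1 // => k _; rewrite [X in (_ * X)%N]ffunE ij muln0.
Qed.

(** To reach its place, X_i crosses exactly the factors X_j with j > i, each crossing costing one
    c. *)
Lemma prod_qcomm (T : nzRingType) (c : T) (X : 'I_r -> T) m i :
    (forall x, GRing.comm c x) ->
    (forall i j, (i < j)%N -> X j * X i = c * (X i * X j)) ->
  (\prod_j X j ^+ m j) * X i = c ^+ mon_above i m * \prod_j X j ^+ mon_incr i m j.
Proof.
move=> cC XC.
have cX x n : x * c ^+ n = c ^+ n * x by exact/commrX/commr_sym.
have XCn j k : (i < j)%N -> X j ^+ k * X i = c ^+ k * (X i * X j ^+ k).
  move=> ij; elim: k => [|k IHk]; first by rewrite !expr0 !mul1r mulr1.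
  rewrite exprS -mulrA IHk mulrA cX.
  rewrite -mulrA [X j * _]mulrA XC // !mulrA -exprSr.
  by rewrite -!mulrA exprS.
have above (s : seq 'I_r) : all (fun j : 'I_r => i < j)%N s ->
    (\prod_(j <- s) X j ^+ m j) * X i
    = c ^+ (\sum_(j <- s) m j) * (X i * \prod_(j <- s) X j ^+ m j).
  elim: s => [|k s IHs] /=; first by rewrite !big_nil expr0 !mul1r mulr1.
  move=> /andP[ik /IHs {}IHs]; rewrite !big_cons -mulrA IHs mulrA.
  rewrite cX -mulrA [_ ^+ m k * _]mulrA XCn //.
  by rewrite !mulrA -exprD addnC.
have main (s : seq 'I_r) : sorted (fun j k : 'I_r => j < k)%N s -> i \in s ->
    (\prod_(j <- s) X j ^+ m j) * X i
    = c ^+ (\sum_(j <- s | (i < j)%N) m j) * \prod_(j <- s) X j ^+ mon_incr i m j.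
  have tr : transitive (fun j k : 'I_r => j < k)%N by move=> x y z; exact: ltn_trans.
  elim: s => //= k s IHs; rewrite path_sortedE // => /andP[ks ss].
  rewrite inE !big_cons; case: eqVneq => /= [ik _|ik si].
    subst k; rewrite ltnn -mulrA above // mulrA cX -mulrA.
    rewrite [_ * (X i * _)]mulrA -exprSr !ffunE eqxx addn1; congr (c ^+ _ * (_ * _)).
      by rewrite big_seq_cond [RHS]big_seq_cond; apply: eq_bigl => j;
        case: (boolP (j \in s)) => //= /(allP ks) ->.
    rewrite big_seq_cond [RHS]big_seq_cond; apply: eq_bigr => j /andP[sj _].
    rewrite !ffunE; case: eqP => [ji|]; last by rewrite addn0.
    by have := allP ks _ sj; rewrite /= ji ltnn.
  have ki := allP ks _ si; rewrite ltnNge (ltnW ki) /= -mulrA IHs // mulrA.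
  rewrite cX -mulrA; congr (_ * (_ ^+ _ * _)).
  by rewrite !ffunE eq_sym (negPf ik) addn0.
have /main : sorted (fun j k : 'I_r => j < k)%N (index_enum 'I_r).
  by rewrite /index_enum locked_withE -enumT sorted_enum_ord.
by apply; rewrite mem_index_enum.
Qed.

Lemma qvar_scaleM (a b : L) j k :
  (a *: qvar q L j) * (b *: qvar q L k) = (a * b) *: (qvar q L j * qvar q L k).
Proof. by rewrite !qspace_scaleU !qspaceUM qspace_scaleU !mulr1 -scalerAr mulr1. Qed.

(** Compare coefficients of x_j x_k: the terms j = k are the column relations, and the terms j < k
    are q times the cross relation. *)
Lemma Xrow_comm A i i' : q \is a GRing.unit -> right_quantum q A -> (i < i')%N ->
  Xrow q A i' * Xrow q A i = (q%:A : L) *: (Xrow q A i * Xrow q A i').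
Proof.
move=> qU [Acol Across] ii'; rewrite /Xrow !big_distrlr /=.
under eq_bigr do under eq_bigr do rewrite qvar_scaleM.
under [in RHS]eq_bigr do under eq_bigr do rewrite qvar_scaleM.
rewrite [LHS]sum_ord_pairs [X in _ *: X]sum_ord_pairs scaler_sumr; apply: eq_bigr => j _.
rewrite scaler_sumr; apply: eq_bigr => k _.
case: ltngtP => [jk|_|jk]; last 2 first.
- by rewrite scaler0.
- by rewrite Acol // scalerA mulr_algl.
rewrite (qvarC q L jk) !scalerA -!scalerDl scalerA; congr (_ *: _).
rewrite !mulr_algl !mulr_algr scalerDr (Across i i' j k) // !scalerBr !scalerDr.
by rewrite !scalerA divrr // scale1r subrK addrC.
Qed.

(** The q-analogue of the action on symmetric powers; its diagonal entries are the [Gcoef]. *)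
Definition Gmx A m l : L := qcoef l (\prod_(i < r) Xrow q A i ^+ m i).

Lemma Gmx_Xrow A m i l : q \is a GRing.unit -> right_quantum q A ->
  qcoef l ((\prod_j Xrow q A j ^+ m j) * Xrow q A i)
  = q ^+ mon_above i m *: Gmx A (mon_incr i m) l.
Proof.
(* The scalar q is realized as a constant monomial, a central element of the ring of the X_i. *)
move=> qU Arq; rewrite (@prod_qcomm _ (qmonom q (q%:A : L) 0)).
- rewrite /Gmx; elim: (mon_above i m) => [|n IHn]; first by rewrite !expr0 mul1r scale1r.
  by rewrite !exprS -mulrA -qspace_scaleE qcoefZ IHn -scalerA mulr_algl.
- move=> p; rewrite /GRing.comm [p]qspaceE mulr_sumr mulr_suml; apply: eq_bigr => l' _.
  rewrite !qspaceUM reorder_exp0m reorder_expm0 expr0 !scale1r add0r addr0.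
  by rewrite mulr_algl mulr_algr.
- by move=> {}i j ij; rewrite Xrow_comm // qspace_scaleE.
Qed.

End Boson.

(** * The exterior side: products of the Omega_j *)

Lemma sum_setD1_pairs (V : nmodType) n (I : {set 'I_n}) (F : 'I_n -> 'I_n -> V) :
  \sum_(i in I) \sum_(j in I :\ i) F i j =
  \sum_(i in I) \sum_(j in I | (i < j)%N) (F i j + F j i).
Proof.
transitivity (\sum_(i in I) (\sum_(j in I | (i < j)%N) F i j + \sum_(j in I | (j < i)%N) F i j)).
  apply: eq_bigr => i _; rewrite (bigID (fun j : 'I_n => (i < j)%N)) /=.
  by congr (_ + _); apply: eq_bigl => j; rewrite !inE -val_eqE /=;
    case: ltngtP => _; rewrite ?andbF ?andbT.
rewrite big_split /= [X in _ + X](exchange_big_dep (fun j => j \in I)) /=; last first.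
  by move=> i j _ /andP[].
rewrite -big_split; apply: eq_bigr => i iI; rewrite big_split /=; congr (_ + _).
by apply: eq_bigl => j; rewrite iI.
Qed.

Section Fermion.
Variables (K : comUnitRingType) (q : K) (L : algType K) (r : nat).
Local Notation ext := {ffun {set 'I_r} -> L}.
Implicit Types (i j k : 'I_r) (A : 'M[L]_r) (I J : {set 'I_r}) (f : ext).

Definition below i J : nat := #|[set k in J | (k < i)%N]|.

(* Left multiplication by Omega_j = sum_i a_ij e_i; f lists the coefficients of *)
(* an element of the q-exterior algebra in the basis of increasing monomials    *)
(* e_I.                                                                         *)
Definition col_wedge A j f : ext :=
  [ffun I : {set 'I_r} => \sum_(i in I) (- q) ^- below i I *: (A i j * f (I :\ i))].

Definition ext_one : ext := [ffun I => (I == finset.set0)%:R].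

Lemma belowD1 i k I : below i (I :\ k) = (below i I - ((k < i) && (k \in I)))%N.
Proof.
rewrite /below; case: (boolP ((k < i) && (k \in I))%N) => kI.
  rewrite [in RHS](cardsD1 k) !inE andbC kI add1n subn1 /=; congr #|pred_of_set _|.
  by apply/setP => x; rewrite !inE andbA.
rewrite subn0; congr #|pred_of_set _|; apply/setP => x; rewrite !inE.
by case: eqP => //= ->; rewrite andbC (negPf kI).
Qed.

Lemma col_wedgeZ A j c f : col_wedge A j (c *: f) = c *: col_wedge A j f.
Proof.
apply/ffunP => I; rewrite !ffunE scaler_sumr; apply: eq_bigr => i _.
by rewrite !ffunE -scalerAr !scalerA mulrC.
Qed.

Lemma col_wedge0 A j : col_wedge A j 0 = 0.
Proof.
by apply/ffunP => I; rewrite !ffunE big1 // => i _; rewrite ffunE mulr0 scaler0.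
Qed.

(** Each pair i < i' can be extracted in two orders, whose reordering factors differ by -q; the two
    terms combine into a 2 by 2 expression to which the right-quantum relations apply. *)
Lemma col_wedge2E A j j' f I : q \is a GRing.unit ->
  col_wedge A j (col_wedge A j' f) I =
  \sum_(i in I) \sum_(i' in I | (i < i')%N)
    ((- q) ^- below i I * (- q) ^- below i' I) *:
      ((A i' j * A i j' - q *: (A i j * A i' j')) * f (I :\ i :\ i')).
Proof.
move=> qU; rewrite ffunE.
under eq_bigr => i _.
  rewrite ffunE mulr_sumr scaler_sumr.
  under eq_bigr => i' _ do rewrite -scalerAr scalerA mulrA.
  over.
rewrite sum_setD1_pairs; apply: eq_bigr => i iI; apply: eq_bigr => i' /andP[iI' ii'].
rewrite !belowD1 iI iI' ii' ltnNge (ltnW ii') /= subn0.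
have -> : I :\ i' :\ i = I :\ i :\ i' by rewrite !setDDl setUC.
rewrite mulrBl scalerBr addrC; congr (_ + _); first by rewrite mulrC.
rewrite -scalerAl scalerA -scaleNr; congr (_ *: _).
(* Removing i lowers the count below i' by one; positivity makes this truncated subtraction exact
   and releases the factor -q. *)
have : (0 < below i' I)%N by apply/card_gt0P; exists i; rewrite inE iI.
case: (below i' I) => // n _; rewrite subn1 /= -mulrN -mulrA; congr (_ * _).
by rewrite exprSr invrM ?unitrX ?unitrN // mulrAC mulVr ?unitrN ?mul1r.
Qed.

Lemma col_wedge_sqr A j f : q \is a GRing.unit -> right_quantum q A ->
  col_wedge A j (col_wedge A j f) = 0.
Proof.
move=> qU [Acol _]; apply/ffunP => I; rewrite col_wedge2E // ffunE.
rewrite big1 // => i iI; rewrite big1 // => i' /andP[iI' ii'].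
by rewrite Acol // subrr mul0r scaler0.
Qed.

Lemma col_wedge_comm A j j' f : q \is a GRing.unit -> right_quantum q A -> (j < j')%N ->
  col_wedge A j' (col_wedge A j f) = (- q)^-1 *: col_wedge A j (col_wedge A j' f).
Proof.
move=> qU [_ Across] jj'; apply/ffunP => I; rewrite col_wedge2E // [RHS]ffunE col_wedge2E //.
rewrite scaler_sumr; apply: eq_bigr => i iI.
rewrite scaler_sumr; apply: eq_bigr => i' /andP[iI' ii'].
rewrite [RHS]scalerA [in RHS]mulrC -[RHS]scalerA; congr (_ *: _).
rewrite [RHS]scalerAl; congr (_ * _).
rewrite (Across i i' j j') // invrN scaleNr scalerBr scalerA mulVr // scale1r opprB.
by rewrite [RHS]addrAC addrK.
Qed.

Definition wedge A (s : seq 'I_r) : ext := foldr (col_wedge A) ext_one s.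

(* The coefficient of e_I in the increasing product of the Omega_j, j in J,     *)
(* i.e. the quantum minor of A with rows I and columns J.                       *)
Definition minor A I J : L := wedge A (enum J) I.

(** Omega_j is moved right to its place among the Omega_k, k in J. Presenting J as a filter of a
    sorted list containing j allows induction on that list. *)
Lemma col_wedge_filter A j J s : q \is a GRing.unit -> right_quantum q A ->
    sorted (fun i k : 'I_r => i < k)%N s -> j \in s ->
  col_wedge A j (wedge A [seq k <- s | k \in J]) =
  if j \in J then 0 else
  (- q) ^- count (fun k => (k \in J) && (k < j)%N) s *:
    wedge A [seq k <- s | k \in j |: J].
Proof.
move=> qU Arq.
have tr : transitive (fun j k : 'I_r => j < k)%N by move=> x y z; exact: ltn_trans.
elim: s => //= k s IHs; rewrite path_sortedE // => /andP[ks ss].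
rewrite inE; move: ks; case: eqVneq => /= [<-{k} ks _ | jk ks js].
  rewrite in_setU1 eqxx /= ltnn andbF /=.
  case: ifP => jJ /=; first by rewrite col_wedge_sqr.
  have -> : count (fun k => (k \in J) && (k < j)%N) s = 0%N.
    apply/eqP; rewrite -leqn0 leqNgt -has_count; apply/hasPn => k /(allP ks) jk.
    by rewrite negb_and orbC -leqNgt (ltnW jk).
  rewrite expr0 invr1 scale1r; congr (col_wedge _ _ (wedge _ _)).
  apply: eq_in_filter => k /(allP ks) jk; rewrite in_setU1.
  by case: eqP => // kj; move: jk; rewrite kj ltnn.
have kj := allP ks _ js; rewrite in_setU1 eq_sym (negPf jk) /= kj andbT.
case: ifP => kJ /=; last by rewrite add0n IHs.
rewrite col_wedge_comm // IHs //; case: ifP => jJ; first by rewrite col_wedge0 scaler0.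
by rewrite col_wedgeZ scalerA exprSr invrM ?unitrX ?unitrN.
Qed.

Lemma col_wedge_minor A I J j : q \is a GRing.unit -> right_quantum q A ->
  col_wedge A j [ffun I => minor A I J] I =
  if j \in J then 0 else (- q) ^- below j J *: minor A I (j |: J).
Proof.
move=> qU Arq; have enumE (B : {set 'I_r}) : enum B = [seq k <- enum 'I_r | k \in B].
  by rewrite enumT; exact: eq_filter.
have -> : [ffun I => minor A I J] = wedge A (enum J) by apply/ffunP => B; rewrite ffunE.
rewrite /minor !enumE col_wedge_filter ?sorted_enum_ord ?mem_enum //.
case: ifP => jJ; rewrite ffunE //; congr (_ ^- _ *: _).
by rewrite /below cardE enumE size_filter; apply: eq_count => k; rewrite !inE.
Qed.

End Fermion.

(** * Diagonal minors are quantum determinants *)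

Fixpoint inversions r (w : seq 'I_r) : nat :=
  if w is i :: w' then (count (fun k : 'I_r => k < i)%N w' + inversions w')%N else 0%N.

Lemma inversionsE r n (w : n.-tuple 'I_r) :
  inversions w = (\sum_(a < n) \sum_(b < n | (a < b)%N) (tnth w b < tnth w a))%N.
Proof.
elim: n w => [|n IHn] w; first by rewrite big_ord0 tuple0.
case/tupleP: w => i w; rewrite big_ord_recl /= IHn; congr (_ + _)%N.
  rewrite big_mkcond big_ord_recl /= add0n -sum1_count big_tuple big_mkcond /=.
  by apply: eq_bigr => b _; rewrite tnth0 tnthS; case: ifP.
apply: eq_bigr => a _; rewrite [RHS]big_mkcond big_ord_recl /= add0n -big_mkcond /=.
by apply: eq_big => b; rewrite ?tnthS // !lift0 ltnS.
Qed.

Lemma enum_val_ltn r (J : {set 'I_r}) (a b : 'I_#|J|) :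
  (enum_val a < enum_val b)%N = (a < b)%N.
Proof.
have H (c d : 'I_#|J|) : (c < d)%N -> (enum_val c < enum_val d)%N.
  move=> cd; have x0 := enum_val c; rewrite (enum_val_nth x0 c) (enum_val_nth x0 d).
  have tr : transitive (fun j k : 'I_r => j < k)%N by move=> x y z; exact: ltn_trans.
  apply: (sorted_ltn_nth tr) => //; rewrite ?inE -?cardE //.
  rewrite /enum_mem; have := sorted_filter tr (mem J) (sorted_enum_ord r).
  by rewrite enumT.
case: (ltngtP a b) => [/H //|/H|/val_inj->]; last by rewrite ltnn.
by case: ltngtP.
Qed.

Section Determinant.
Variables (K : comUnitRingType) (q : K) (L : algType K) (r : nat).
Implicit Types (A : 'M[L]_r) (I J : {set 'I_r}).

Lemma perm_eq_enum_cons (i : 'I_r) (w : seq 'I_r) I :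
  perm_eq (i :: w) (enum I) = (i \in I) && perm_eq w (enum (I :\ i)).
Proof.
case: (boolP (i \in I)) => iI /=; last first.
  by apply: contraNF iI => /perm_mem/(_ i); rewrite mem_head mem_enum => <-.
have /permPr-> : perm_eq (enum I) (i :: enum (I :\ i)).
  apply: uniq_perm; rewrite /= ?enum_uniq ?mem_enum ?setD11 // => k.
  by rewrite inE !mem_enum in_setD1; case: eqP => [->|].
by rewrite perm_cons.
Qed.

(** The first letter i of w is the row taken from the first factor. The rest of w arranges I minus
    i, so its letters smaller than i number [below i I], which matches the recursion of
    [inversions]. *)
Lemma wedge_expand A n (js : n.-tuple 'I_r) I :
  wedge q A js I = \sum_(w : n.-tuple 'I_r | perm_eq w (enum I))
    (- q) ^- inversions w *: \prod_(t < n) A (tnth w t) (tnth js t).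
Proof.
elim: n js I => [|n IHn] js I.
  rewrite tuple0 ffunE; case: eqP => [->|I0].
    rewrite (big_pred1 [tuple]) ?big_ord0 ?expr0 ?invr1 ?scale1r // => w.
    by rewrite tuple0 /= enum_set0 perm_refl.
  rewrite big1 // => w; rewrite tuple0 perm_sym => /perm_nilP eI.
  by case: I0; apply/setP => x; rewrite finset.in_set0 -mem_enum eI.
case/tupleP: js => j js; rewrite ffunE.
rewrite (reindex (fun p : 'I_r * n.-tuple 'I_r => [tuple of p.1 :: p.2])) /=; last first.
  exists (fun w => (thead w, [tuple of behead w])) => [[i w] _|w _] /=.
    by rewrite theadE; congr pair; apply: val_inj.
  by rewrite [RHS]tuple_eta.
under [RHS]eq_bigl do rewrite perm_eq_enum_cons.
rewrite -(pair_big_dep (fun i => i \in I) (fun i (w : n.-tuple 'I_r) => perm_eq w (enum (I :\ i)))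
  (fun i (w : n.-tuple 'I_r) => (- q) ^- (count (fun k : 'I_r => k < i)%N w + inversions w)%N *:
    \prod_(t < n.+1) A (tnth [tuple of i :: w] t) (tnth [tuple of j :: js] t))) /=.
apply: eq_bigr => i iI; rewrite IHn mulr_sumr scaler_sumr; apply: eq_bigr => w wI.
rewrite -scalerAr scalerA big_ord_recl !tnth0; congr (_ *: (_ * _)).
  rewrite -!exprVn exprD; congr (_ ^+ _ * _).
  rewrite (seq.permP wI) -size_filter /below cardE /enum_mem -filter_predI !size_filter.
  apply: eq_count => k /=; rewrite !inE andbA [RHS]andbC andbA.
  by case: eqP => [->|]; rewrite ?ltnn ?andbF ?andbT.
by apply: eq_bigr => t _; rewrite !tnthS.
Qed.

(** Arrangements of J correspond to permutations of its positions, and [enum_val] is increasing, so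
    inversions are preserved. *)
Lemma minor_diag A J : minor q A J J = qdet q (principal_submx A J).
Proof.
rewrite /minor; have -> : enum J = enum_tuple J by [].
rewrite wedge_expand.
have tE (w : #|J|.-tuple 'I_r) : perm_eq w (enum J) ->
  exists s : 'S_#|J|, w = [tuple enum_val (s i) | i < #|J|].
  have {1}-> : enum J = enum_tuple J by [].
  move=> /tuple_permP[s ws]; exists s; apply: val_inj; rewrite /= ws.
  apply: eq_map => i; rewrite (tnth_nth (enum_val (s i))) -enum_val_nth //.
pose f (s : 'S_#|J|) := [tuple enum_val (s i) | i < #|J|].
have f_inj : injective f.
  move=> s s' /(congr1 (fun w => tnth w)) ss; apply/permP => i; apply: enum_val_inj.
  by have := congr1 (fun g => g i) ss; rewrite !tnth_mktuple.
rewrite (eq_bigl (fun w => w \in f @: finset.setT)).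
  rewrite big_imset /=; last by move=> s s' _ _; exact: f_inj.
  apply: eq_big => [s|s _]; first by rewrite inE.
  congr (_ ^- _ *: _).
    rewrite (inversionsE (f s)) /Defs.perm_inv -sum1dep_card.
    rewrite -(pair_big_dep xpredT (fun a b : 'I_#|J| => (a < b)%N && (s b < s a)%N)
      (fun _ _ => 1%N)) /=.
    apply: eq_bigr => a _; rewrite [RHS]big_mkcondr; apply: eq_bigr => b _.
    by rewrite !tnth_mktuple enum_val_ltn; case: ifP.
  apply: eq_bigr => t _; rewrite mxE tnth_mktuple; congr (A _ _).
  by rewrite (tnth_nth (enum_val t)) -enum_val_nth.
move=> w; apply/idP/imsetP => [/tE[s ->]|[s _ ->]]; first by exists s.
apply/(@tuple_permP _ _ _ (enum_tuple J)); exists s; apply: eq_map => i.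
by rewrite (tnth_nth (enum_val (s i))) -enum_val_nth.
Qed.

End Determinant.

(** * The monomial basis of the Koszul complex *)

Section KoszulBasis.
Variable r : nat.
Local Notation mon := {ffun 'I_r -> nat}.
Local Notation basis := (mon * {set 'I_r})%type.
Implicit Types (i j p : 'I_r) (m : mon) (I J : {set 'I_r}) (u v w : basis).

Definition mon_deg m : nat := (\sum_i m i)%N.

Definition mons d : seq mon :=
  [seq m <- [seq [ffun i => nat_of_ord (f i)] | f : {ffun 'I_r -> 'I_d.+1}] | mon_deg m == d].

Lemma mons_uniq d : uniq (mons d).
Proof.
apply/filter_uniq; rewrite map_inj_uniq ?enum_uniq // => f g fg.
by apply/ffunP => i; apply: val_inj; have /ffunP/(_ i) := fg; rewrite !ffunE.
Qed.

Lemma mem_mons d m : (m \in mons d) = (mon_deg m == d).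
Proof.
rewrite mem_filter; case: eqP => //= md; apply/imageP.
have mi i : (m i < d.+1)%N by rewrite ltnS -md /mon_deg (bigD1 i) //= leq_addr.
by exists [ffun i => Ordinal (mi i)] => //; apply/ffunP => i; rewrite !ffunE.
Qed.

Definition kbasis n : seq basis :=
  [seq (m, J) | J <- enum {set 'I_r}, m <- if (#|J| <= n)%N then mons (n - #|J|)%N else [::]].

Lemma kbasis_uniq n : uniq (kbasis n).
Proof.
apply: allpairs_uniq_dep; first exact: enum_uniq.
  by move=> I _; case: ifP; rewrite ?mons_uniq.
by move=> [I m] [I' m'] _ _ /= [-> ->].
Qed.

Lemma mem_kbasis n u : (u \in kbasis n) = (mon_deg u.1 + #|u.2| == n)%N.
Proof.
case: u => m I; apply/allpairsPdep/eqP => /= [[I' [m' [_ + [-> ->]]]]|<-].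
  by case: ifP => // In; rewrite mem_mons => /eqP->; rewrite subnK.
by exists I, m; rewrite mem_enum leq_addl addnK mem_mons.
Qed.

(* The pair (m, I) stands for x^m e_I. *)
Definition kup i u : basis := (mon_incr i u.1, u.2 :\ i).
Definition kdown i u : basis := (mon_decr i u.1, i |: u.2).

Lemma mon_deg_incr i m : mon_deg (mon_incr i m) = (mon_deg m).+1.
Proof.
rewrite /mon_deg; under eq_bigr do rewrite ffunE.
by rewrite big_split /= -addn1; congr (_ + _)%N; rewrite (bigD1 i) //= eqxx big1 // => j /negPf->.
Qed.

Lemma kupK i u : i \in u.2 -> kdown i (kup i u) = u.
Proof. by case: u => m I iI; rewrite /kdown /= mon_incrK setD1K. Qed.

Lemma kdownK i u : i \notin u.2 -> (0 < u.1 i)%N -> kup i (kdown i u) = u.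
Proof. by case: u => m I /= iI mi; rewrite /kup /= mon_decrK // setU1K. Qed.

Lemma kup_kbasis n i u : i \in u.2 -> u \in kbasis n -> kup i u \in kbasis n.
Proof.
rewrite !mem_kbasis => iI /eqP <-.
by rewrite /= mon_deg_incr (cardsD1 i u.2) iI add1n addSnnS.
Qed.

(** Inverts the elementary moves, so that columns of the differential can be summed like its
    rows. *)
Lemma kup_eqE i v w :
  (i \in v.2) && (w == kup i v) = (i \notin w.2) && (0 < w.1 i)%N && (v == kdown i w).
Proof.
apply/idP/idP => [/andP[iv /eqP->]|/andP[/andP[iw wi] /eqP->]].
  by rewrite kupK // eqxx !inE eqxx ffunE eqxx addn1.
by rewrite kdownK // eqxx setU11.
Qed.

Lemma kdown_kbasis n i u : i \notin u.2 -> (0 < u.1 i)%N -> u \in kbasis n ->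
  kdown i u \in kbasis n.
Proof.
move=> iu ui; rewrite -{1}(kdownK iu ui) !mem_kbasis /= => /eqP <-.
by rewrite mon_deg_incr setU1K // cardsU1 iu add1n addSnnS.
Qed.

Definition ksupp u : pred 'I_r := fun i => (i \in u.2) || (0 < u.1 i)%N.
Definition klead u i : bool := ksupp u i && [forall j : 'I_r, (j < i)%N ==> ~~ ksupp u j].

Lemma klead_uniq u i j : klead u i -> klead u j -> i = j.
Proof.
move=> /andP[ui /forallP iu] /andP[uj /forallP ju]; apply: ord_inj.
case: (ltngtP i j) => // ij; first by have /implyP/(_ ij) := ju i; rewrite ui.
by have /implyP/(_ ij) := iu j; rewrite uj.
Qed.

Lemma klead_exists n u : u \in kbasis n.+1 -> exists i, klead u i.
Proof.
rewrite mem_kbasis => /eqP un.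
have [i ui|u0] := pickP (ksupp u); last first.
  suff : (mon_deg u.1 + #|u.2|)%N = 0%N by rewrite un.
  rewrite /mon_deg big1 ?add0n => [|i _]; last first.
    by have /norP[_] := negbT (u0 i); rewrite -eqn0Ngt => /eqP.
  apply/eqP; rewrite cards_eq0; apply/eqP/setP => i; rewrite inE.
  by have /norP[/negPf] := negbT (u0 i).
have [p up pmin] := arg_minnP val ui; exists p; rewrite /klead up /=.
apply/forallP => j; apply/implyP => jp; apply/negP => /pmin /=.
by rewrite leqNgt jp.
Qed.

(** The differential trades e_i for x_i, so the variables that occur, and hence the one being
    contracted, stay the same. *)
Lemma ksupp_kup i u : i \in u.2 -> ksupp (kup i u) =1 ksupp u.
Proof.
move=> iu j; rewrite /ksupp /= !inE ffunE; case: eqP => [->|_] /=; last by rewrite addn0.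
by rewrite iu addn1.
Qed.

Lemma klead_kup i u : i \in u.2 -> klead (kup i u) =1 klead u.
Proof.
move=> iu j; rewrite /klead ksupp_kup //; congr (_ && _).
by apply: eq_forallb => k; rewrite ksupp_kup.
Qed.

End KoszulBasis.

(** * Differential, contracting homotopy and vanishing supertrace *)

Section Koszul.
Variables (K : comUnitRingType) (q : K) (L : algType K) (r : nat) (A : 'M[L]_r).
Hypotheses (qU : q \is a GRing.unit) (Arq : right_quantum q A).
Local Notation mon := {ffun 'I_r -> nat}.
Local Notation basis := (mon * {set 'I_r})%type.
Implicit Types (i j p : 'I_r) (m : mon) (I J : {set 'I_r}) (u v w : basis).

(* For i in u.2 = I and u.1 = m, x^m x_i = q^a x^(m + i) and                    *)
(* e_i e_(I - i) = (- q)^-b e_I with a = mon_above i m and b = below i I.       *)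
Definition kcoef i u : K := q ^+ mon_above i u.1 * (- q) ^- below i u.2.

Definition kdiff u v : K := \sum_(i | (i \in u.2) && (v == kup i u)) kcoef i u.

(* Contracts the Koszul complex of the least variable occurring in u, the other *)
(* variables being parameters; in one variable it maps x^(n + 1) to x^n e.      *)
Definition khomotopy u v : K :=
  \sum_(i | klead u i && ((i \notin u.2) && (v == kdown i u))) (kcoef i (kdown i u))^-1.

Definition ktrans u v : L := Gmx q A u.1 v.1 * minor q A u.2 v.2.

Lemma kcoef_unit i u : kcoef i u \is a GRing.unit.
Proof. by rewrite unitrM unitrV !unitrX ?unitrN. Qed.

Lemma sum_kdiffl (V : lmodType K) n u (F : basis -> V) : u \in kbasis r n ->
  \sum_(v <- kbasis r n) kdiff u v *: F v = \sum_(i in u.2) kcoef i u *: F (kup i u).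
Proof.
move=> un; under eq_bigr do rewrite scaler_suml.
rewrite (exchange_big_dep (mem u.2)) /=; last by move=> v i _ /andP[].
apply: eq_bigr => i iu; under eq_bigl => v do rewrite iu /=.
by rewrite big_seq_pred1 ?kbasis_uniq // kup_kbasis.
Qed.

Lemma sum_kdiffr (V : lmodType K) n w (F : basis -> V) : w \in kbasis r n ->
  \sum_(v <- kbasis r n) kdiff v w *: F v =
  \sum_(i | (i \notin w.2) && (0 < w.1 i)%N) kcoef i (kdown i w) *: F (kdown i w).
Proof.
move=> wn; under eq_bigr do rewrite scaler_suml.
rewrite (exchange_big_dep (fun i => (i \notin w.2) && (0 < w.1 i)%N)) /=; last first.
  by move=> v i _; rewrite kup_eqE => /andP[].
apply: eq_bigr => i iw; under eq_bigl => v do rewrite kup_eqE iw /=.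
have /andP[iw1 iw2] := iw.
by rewrite big_seq_pred1 ?kbasis_uniq // kdown_kbasis.
Qed.

Lemma khomotopyE u p v : klead u p -> khomotopy u v =
  if (p \notin u.2) && (v == kdown p u) then (kcoef p (kdown p u))^-1 else 0.
Proof.
move=> up; rewrite /khomotopy (eq_bigl (fun i => (i == p) && ((i \notin u.2) && (v == kdown i u)))).
  by rewrite big_mkcondr big_pred1_eq.
move=> i /=; case: (eqVneq i p) => [->|/eqP ip]; first by rewrite up.
by case: (boolP (klead u i)) => // /(klead_uniq up)/esym.
Qed.

Lemma kdiffE u v : kdiff u v = \sum_(i in u.2) (if v == kup i u then kcoef i u else 0).
Proof. exact: big_mkcondr. Qed.

Lemma mon_above_neq i j m m' : (forall k, k != j -> m k = m' k) -> (j <= i)%N ->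
  mon_above i m = mon_above i m'.
Proof.
move=> mm' ji; apply: eq_bigr => k ik; apply: mm'.
by apply: contraTneq ik => ->; rewrite -leqNgt.
Qed.

Lemma mon_above_incr i p m : (p < i)%N -> mon_above p (mon_incr i m) = (mon_above p m).+1.
Proof.
move=> pi; rewrite /mon_above (bigD1 i) //= [in RHS](bigD1 i) //= ffunE eqxx addn1 addSn.
by congr (_ + _).+1; apply: eq_bigr => j /andP[_ /negPf ji]; rewrite ffunE ji addn0.
Qed.

Lemma belowU1 i k I : k \notin I -> below i (k |: I) = (below i I + (k < i)%N)%N.
Proof.
move=> kI; have := belowD1 i k (k |: I); rewrite setU1K // setU11 andbT => ->.
case: ltnP => ki; last by rewrite subn0 addn0.
by rewrite subnK // card_gt0; apply/set0Pn; exists k; rewrite !inE eqxx.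
Qed.

(** An additional x_i above p costs q on one side, and an additional e_p below i costs -q on the
    other; the mismatch is the sign that makes the two paths cancel. *)
Lemma kcoef_cancel i p u : (p < i)%N -> i \in u.2 -> p \notin u.2 ->
  kcoef i u * (kcoef p (kdown p (kup i u)))^-1
  = - ((kcoef p (kdown p u))^-1 * kcoef i (kdown p u)).
Proof.
move=> pi iu pu; rewrite /kcoef /=.
have decrE k m : k != p -> mon_decr p m k = m k by move=> /negPf kp; rewrite ffunE kp subn0.
rewrite (mon_above_neq (fun k => decrE k _) (leqnn p)) mon_above_incr //.
rewrite (mon_above_neq (fun k => decrE k _) (leqnn p)).
rewrite (mon_above_neq (fun k => decrE k _) (ltnW pi)).
rewrite !belowU1 // ?inE ?(negPf pu) ?andbF // belowD1 !ltnn !addn0 pi addn1.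
rewrite ltnNge (ltnW pi) /= subn0.
move: (below i _) (below p _) (mon_above i _) (mon_above p _) => c d a b.
have -> : (- q) ^- c.+1 = - ((- q) ^- c * q^-1) by rewrite -!exprVn exprSr invrN mulrN.
rewrite exprS -(mulrA q) invrM ?unitrM ?unitrV ?unitrX ?unitrN // !mulrN opprK.
by rewrite mulrA [_ * (_ * _)^-1]mulrC -!mulrA.
Qed.

Lemma khomotopyP n : {in kbasis r n.+1 &, forall u w,
  \sum_(v <- kbasis r n.+1) (kdiff u v * khomotopy v w + khomotopy u v * kdiff v w)
  = (u == w)%:R}.
Proof.
move=> u w un wn; rewrite big_split /=.
rewrite (sum_kdiffl (khomotopy^~ w : basis -> K^o) un) /=.
have [p up] := klead_exists un.
have E i : i \in u.2 -> khomotopy (kup i u) w =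
    if (p \notin u.2 :\ i) && (w == kdown p (kup i u))
    then (kcoef p (kdown p (kup i u)))^-1 else 0.
  by move=> iu; apply: khomotopyE; rewrite klead_kup.
under eq_bigr => i iu do rewrite E //.
(* If e_p occurs, the homotopy kills u and every term of its differential in which e_p remains; only
   the move of p survives and is undone. *)
case: (boolP (p \in u.2)) => pu.
  rewrite [X in _ + X]big1 ?addr0; last first.
    by move=> v _; rewrite (khomotopyE _ up) pu mul0r.
  rewrite (bigD1 p) //= big1 ?addr0.
    rewrite setD11 kupK //= eq_sym; case: eqP => _; last by rewrite scaler0.
    exact/divrr/kcoef_unit.
  by move=> i /andP[iu ip]; rewrite !inE eq_sym ip pu /= scaler0.
have up0 : (0 < u.1 p)%N by have /andP[] := up; rewrite /ksupp (negPf pu).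
under [X in _ + X]eq_bigr => v _ do rewrite (khomotopyE _ up) pu /=.
under [X in _ + X]eq_bigr => v _ do rewrite (fun_if (fun x => x * kdiff v w)) mul0r.
rewrite -big_mkcond big_seq_pred1 ?kbasis_uniq // kdown_kbasis // kdiffE big_setU1 //=.
rewrite kdownK // mulrDr addrCA [RHS]mulrb eq_sym [X in _ + X](_ : _ = 0) ?addr0.
  by case: eqP => _; rewrite ?mulr0 ?mulVr ?kcoef_unit.
(* Moving p down and back up has already given u; the moves of the other i, all larger than p,
   cancel in pairs by [kcoef_cancel]. *)
rewrite mulr_sumr -big_split big1 //= => i iu.
have ip : i != p by apply: contraNneq pu => <-.
have pi : (p < i)%N.
  rewrite ltn_neqAle eq_sym ip leqNgt; apply/negP => ip'.
  by have /andP[_ /forallP/(_ i)/implyP/(_ ip')] := up; rewrite /ksupp iu.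
have -> : kup i (kdown p u) = kdown p (kup i u).
  congr pair; first by apply/ffunP => k; rewrite !ffunE; case: (eqVneq k i) => [->|_];
    rewrite ?(negPf ip) ?subn0 ?addn0.
  by apply/setP => k; rewrite !inE; case: (eqVneq k i) => [->|_] //; rewrite (negPf ip).
rewrite !inE (negPf pu) andbF /=; case: eqP => _; last by rewrite scaler0 mulr0 addr0.
by rewrite -[_ *: _]/(_ * _) kcoef_cancel // addNr.
Qed.

(* Both sides are the coefficient of x^l e_I, w = (l, J), in                    *)
(* X^m (sum_i X_i e_i) Omega_J = X^m (sum_j x_j Omega_j) Omega_J.               *)
Lemma ktrans_diff n : {in kbasis r n &, forall u w,
  \sum_(v <- kbasis r n) kdiff u v *: ktrans v w
  = \sum_(v <- kbasis r n) kdiff v w *: ktrans u v}.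
Proof.
move=> u w un wn; rewrite sum_kdiffl // sum_kdiffr //.
pose X := \prod_j Xrow q A j ^+ u.1 j.
transitivity (\sum_j qcoef w.1 (X * qvar q L j) * col_wedge q A j [ffun I => minor q A I w.2] u.2).
  under [RHS]eq_bigr do rewrite ffunE mulr_sumr.
  rewrite exchange_big; apply: eq_bigr => i iu /=.
  transitivity (qcoef w.1 (X * Xrow q A i) * ((- q) ^- below i u.2 *: minor q A (u.2 :\ i) w.2)).
    by rewrite Gmx_Xrow // /ktrans /kcoef -scalerAr -scalerAl scalerA mulrC.
  rewrite /Xrow mulr_sumr raddf_sum mulr_suml; apply: eq_bigr => j _ /=.
  by rewrite qcoef_Zvar ffunE -!scalerAr mulrA.
rewrite [RHS]big_mkcond; apply: eq_bigr => j _.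
rewrite col_wedge_minor // qcoef_var; case: (boolP (j \in w.2)) => jw /=; first by rewrite mulr0.
case: ifP => wj; last by rewrite mul0r.
rewrite /ktrans /kcoef /= belowU1 // ltnn addn0.
by rewrite -scalerAl -scalerAr scalerA.
Qed.

Theorem koszul_supertrace n :
  \sum_(u <- kbasis r n.+1) (-1) ^+ #|u.2| *: ktrans u u = 0.
Proof.
apply: (supertrace_eq0 (kbasis_uniq r n.+1) (@ktrans_diff n.+1) (@khomotopyP n)).
move=> u v; rewrite /kdiff !mulr_sumr -sumrN; apply: eq_bigr => i /andP[iu /eqP->] /=.
by rewrite [in LHS](cardsD1 i) iu exprS mulN1r mulNr.
Qed.

End Koszul.

(** * Homogeneous components and conclusion *)

Section Components.
Variables (K : comUnitRingType) (q : K) (r : nat).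
Local Notation A := (rq_mx q r).

Lemma hcomp_Bos n : hcomp (Bos A) n = \sum_(m <- mons r n) Gcoef q A m.
Proof.
rewrite (eq_big_seq (fun m => rq_comp n (Gcoef q A m))); last first.
  move=> m; rewrite mem_mons => /eqP mn.
  by rewrite (rq_compE n (Gcoef_homog q m)) -/(mon_deg m) mn eqxx.
rewrite fsbig_seq ?mons_uniq //; apply/esym/fsbig_widen => // m [_ /=].
rewrite mem_mons => /negP nm.
by rewrite (rq_compE n (Gcoef_homog q m)) -/(mon_deg m) eq_sym (negPf nm).
Qed.

Lemma mons0 : mons r 0 = [:: 0].
Proof.
apply: perm_small_eq => //; apply: uniq_perm; rewrite ?mons_uniq // => m.
rewrite mem_mons inE sum_nat_eq0; apply/forallP/eqP => [m0|-> i]; last by rewrite ffunE.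
by apply/ffunP => i; rewrite ffunE; apply/eqP/m0.
Qed.

Lemma Gcoef0 : Gcoef q A 0 = 1.
Proof.
rewrite /Gcoef big1 => [|i _]; last by rewrite ffunE.
by rewrite -qmonom1 qcoef_monom eqxx.
Qed.

Lemma rq_homog_prod n (F : 'I_n -> rqalg q r) :
  (forall i, rq_homog 1 (F i)) -> rq_homog n (\prod_(i < n) F i).
Proof.
elim: n F => [|n IHn] F hF; first by rewrite big_ord0; exact: rq_homog1.
by rewrite big_ord_recl; apply: (@RqHomogM _ _ _ 1); [exact: hF | apply: IHn].
Qed.

Lemma hcomp_Ferm n : hcomp (to_completion (Ferm q A)) n =
  \sum_(J : {set 'I_r} | #|J| == n) (-1 : K) ^+ #|J| *: minor q A J J.
Proof.
rewrite /= /Ferm raddf_sum /= [RHS]big_mkcond; apply: eq_bigr => J _.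
have -> : (-1) ^+ #|J| * qdet q (principal_submx A J)
    = (-1 : K) ^+ #|J| *: minor q A J J.
  by rewrite minor_diag -signr_odd -[in RHS]signr_odd mulr_sign scaler_sign.
rewrite (@rq_compE _ _ _ _ #|J|) 1?eq_sym; first by case: eqP.
apply: rq_homogZ; rewrite minor_diag; apply: rq_homog_sum => s _; apply: rq_homogZ.
by apply: rq_homog_prod => j; rewrite !mxE; constructor.
Qed.

Lemma Bos_mul_Ferm : q \is a GRing.unit -> Bos A * to_completion (Ferm q A) = 1.
Proof.
move=> qU; apply: completionP => n.
transitivity (\sum_(u <- kbasis r n) (-1 : K) ^+ #|u.2| *: ktrans q A u u).
  rewrite hcompM; under eq_bigr do rewrite hcomp_Bos hcomp_Ferm mulr_sumr.
  rewrite /kbasis big_allpairs_dep /=.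
  rewrite (exchange_big_dep (fun J : {set 'I_r} => (#|J| <= n)%N)) /=; last first.
    by move=> k J _ /eqP->; exact: leq_subr.
  rewrite [RHS]big_enum [LHS]big_mkcond; apply: eq_bigr => J _.
  case: leqP => Jn; last by rewrite big_nil.
  have nJ : (n - #|J| < n.+1)%N by rewrite ltnS leq_subr.
  rewrite (big_pred1 (Ordinal nJ)) /= => [|k].
    by rewrite mulr_suml; apply: eq_bigr => m _; rewrite -scalerAr.
  apply/eqP/eqP => [kJ|->] /=; last by rewrite subKn.
  by apply: val_inj; rewrite /= kJ subKn // -ltnS.
(* The supertrace vanishes in positive degree; in degree 0 the basis is the single pair (0, empty
   set), with entry 1. *)
case: n => [|n]; last by rewrite koszul_supertrace //; exact: rq_mx_right_quantum.
have -> : kbasis r 0 = [:: (0, finset.set0)].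
  apply: perm_small_eq => //; apply: uniq_perm; rewrite ?kbasis_uniq // => -[m J].
  by rewrite mem_kbasis /= addn_eq0 cards_eq0 -mem_mons mons0 !inE xpair_eqE.
rewrite big_seq1 cards0 expr0 scale1r /ktrans -[Gmx _ _ _ _]/(Gcoef q A 0) Gcoef0.
by rewrite /minor enum_set0 ffunE eqxx mul1r hcomp1.
Qed.

End Components.

Theorem theorem1 (K : comUnitRingType) (q : K) (r : nat)
    (q_unit : q \is a GRing.unit) (r_gt0 : (1 <= r)%N) :
  let A : 'M[rqalg q r]_r := rq_mx q r in
  to_completion (Ferm q A) \is a GRing.unit /\
  Bos A = (to_completion (Ferm q A))^-1.
Proof.
apply: completion_rinv_unit; last exact: Bos_mul_Ferm.
by rewrite hcomp_Bos mons0 big_seq1 Gcoef0.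
Qed.
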